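(* For every right-angled Artin group $G$, there exists a continuum of countable groups (a family of countable groups of cardinality $2^{\aleph_0}$) that are measure equivalent to $G$ but pairwise not commensurable up to finite kernels.
   Context: Given a finite simple graph $\Gamma$ with vertex set $V\Gamma$, the right-angled Artin group $G_\Gamma$ is $\langle V\Gamma \mid [v,w]=1$ whenever $v,w$ are joined by an edge$\rangle$; a right-angled Artin group is a group of this form. Two groups $H_1,H_2$ are commensurable up to finite kernels if there exist finite-index subgroups $H_i^0\subseteq H_i$ and finite normal subgroups $F_i\trianglelefteq H_i^0$ ($i=1,2$) such that $H_1^0/F_1\cong H_2^0/F_2$. Two countable groups $G$ and $H$ are measure equivalent if there exists a standard measure space $\Sigma$ (with a nonzero $\sigma$-finite measure) equipped with a measure-preserving action of $G\times H$ by Borel automorphisms such that the action of each of the two factors on $\Sigma$ is essentially free and has a fundamental domain of finite measure.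
   Formalization: The graph is assumed to have at least one vertex: for the empty graph G is trivial, every group measure equivalent to it is finite, and all finite groups are commensurable up to finite kernels, so the claim fails there. *)

(* Defs.v *)
From HB Require Import structures.
From mathcomp Require Import all_boot all_order all_algebra.
From mathcomp Require Import all_classical all_reals all_analysis.

Set Implicit Arguments.
Unset Strict Implicit.
Unset Printing Implicit Defensive.

Local Open Scope classical_set_scope.
Local Open Scope ring_scope.
Local Open Scope group_scope.
Local Open Scope quotient_scope.

(* A word over V is a list of letters: (v, false) stands for v and (v, true)
   for the inverse of v. *)
Notation word V := (seq (V * bool)).

Section PresentedGroup.
Variables (V : choiceType) (rels : set (word V)).

(* The congruence on words whose quotient is the group < V | rels >. *)
Inductive word_eq : word V -> word V -> Prop :=
| WordRefl w : word_eq w w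
| WordSym w1 w2 : word_eq w1 w2 -> word_eq w2 w1
| WordTrans w1 w2 w3 : word_eq w1 w2 -> word_eq w2 w3 -> word_eq w1 w3
| WordCat w1 w1' w2 w2' :
    word_eq w1 w1' -> word_eq w2 w2' -> word_eq (w1 ++ w2) (w1' ++ w2')
| WordCancel v b : word_eq [:: (v, b); (v, ~~ b)] [::]
| WordRel w : rels w -> word_eq w [::].

Definition word_eqb : rel (word V) := fun w1 w2 => `[< word_eq w1 w2 >].

Lemma word_eqb_refl : reflexive word_eqb.
Proof. by move=> w; apply/asboolP; exact: WordRefl. Qed.

Lemma word_eqb_sym : symmetric word_eqb.
Proof. by move=> w1 w2; apply/asboolP/asboolP; exact: WordSym. Qed.

Lemma word_eqb_trans : transitive word_eqb.
Proof.
by move=> w2 w1 w3 /asboolP h12 /asboolP h23; apply/asboolP/(WordTrans h12 h23).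
Qed.

Canonical word_equiv := EquivRel word_eqb word_eqb_refl word_eqb_sym
  word_eqb_trans.

Definition presented := {eq_quot word_eqb}.
HB.instance Definition _ := EqQuotient.on presented.
HB.instance Definition _ := Choice.on presented.

Definition presented_class (w : word V) : presented := \pi w.

Lemma presented_classP w1 w2 :
  presented_class w1 = presented_class w2 <-> word_eq w1 w2.
Proof.
by split=> [/eqmodP /asboolP|h] //; apply/eqmodP/asboolP.
Qed.

Lemma presented_reprK (x : presented) : presented_class (repr x) = x.
Proof. exact: reprK. Qed.

Lemma word_eq_repr w : word_eq (repr (presented_class w)) w.
Proof. by apply/presented_classP; rewrite presented_reprK. Qed.

Definition word_inv (w : word V) : word V :=
  rev [seq (l.1, ~~ l.2) | l <- w].

Lemma word_invK : involutive word_inv.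
Proof.
move=> w; rewrite /word_inv map_rev revK -map_comp -[RHS]map_id.
by apply: eq_map => -[v b] /=; rewrite negbK.
Qed.

Lemma word_eq_mulV w : word_eq (w ++ word_inv w) [::].
Proof.
elim: w => [|[v b] w ih]; first exact: WordRefl.
have -> : ((v, b) :: w) ++ word_inv ((v, b) :: w)
    = [:: (v, b)] ++ (w ++ word_inv w) ++ [:: (v, ~~ b)].
  by rewrite /word_inv /= rev_cons -cats1 /= !catA.
apply: WordTrans (WordCancel v b).
apply: (@WordCat _ [:: (v, b)] _ [:: (v, ~~ b)] (WordRefl _)).
exact: (WordCat ih (WordRefl _)).
Qed.

Lemma word_eq_mulVl w : word_eq (word_inv w ++ w) [::].
Proof. by rewrite -{2}(word_invK w); exact: word_eq_mulV. Qed.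

Definition presented_one : presented := presented_class [::].
Definition presented_mul (x y : presented) : presented :=
  presented_class (repr x ++ repr y).
Definition presented_inv (x : presented) : presented :=
  presented_class (word_inv (repr x)).

Lemma presented_mulA : associative presented_mul.
Proof.
move=> x y z; apply/presented_classP.
apply: (@WordTrans _ (repr x ++ repr y ++ repr z)).
  exact: (WordCat (WordRefl _) (word_eq_repr _)).
by rewrite catA; exact: (WordCat (WordSym (word_eq_repr _)) (WordRefl _)).
Qed.

Lemma presented_mul1 : left_id presented_one presented_mul.
Proof.
move=> x; rewrite -[RHS]presented_reprK; apply/presented_classP.
exact: (WordCat (word_eq_repr _) (WordRefl _)).
Qed.

Lemma presented_mulr1 : right_id presented_one presented_mul.
Proof.
move=> x; rewrite -[RHS]presented_reprK; apply/presented_classP.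
by rewrite -[X in word_eq _ X]cats0; exact: (WordCat (WordRefl _) (word_eq_repr _)).
Qed.

Lemma presented_mulV : left_inverse presented_one presented_inv presented_mul.
Proof.
move=> x; apply/presented_classP.
exact: WordTrans (WordCat (word_eq_repr _) (WordRefl _)) (word_eq_mulVl _).
Qed.

Lemma presented_mulrV : right_inverse presented_one presented_inv presented_mul.
Proof.
move=> x; apply/presented_classP.
exact: WordTrans (WordCat (WordRefl _) (word_eq_repr _)) (word_eq_mulV _).
Qed.

HB.instance Definition _ := isGroup.Build presented
  presented_mulA presented_mul1 presented_mulr1 presented_mulV presented_mulrV.

End PresentedGroup.

(* The relator v^-1 w^-1 v w is the library's commutator [~ v, w]. *)
Definition raag_relators (V : finType) (e : rel V) : set (word V) :=
  [set r | exists v w, e v w /\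
     r = [:: (v, true); (w, true); (v, false); (w, false)]].

Definition raag (V : finType) (e : rel V) : groupType :=
  presented (raag_relators e).

Section Subgroup.
Variables (G : groupType) (S : groupClosed G).

Definition subgroup := {x : G | x \in S}.
HB.instance Definition _ := SubChoice.on subgroup.

Lemma subgroup_closed : group_closed [pred x : G | x \in S].
Proof.
by split=> [|x y]; rewrite !inE ?gpred1 // => xS yS; rewrite gpredF.
Qed.

HB.instance Definition _ :=
  SubChoice_isSubGroup.Build G [pred x : G | x \in S] subgroup subgroup_closed.

Definition finite_index :=
  finite_set (range (fun g : G => [set g * x | x in [set` S]])).

End Subgroup.

Record normal_subgroup (G : groupType) := NormalSubgroup {
  normal_pred :> groupClosed G;
  normal_conj : forall x y : G, x \in normal_pred -> x ^ y \in normal_pred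
}.

Section Quotient.
Variables (G : groupType) (N : normal_subgroup G).

Definition coset_rel : rel G := fun x y => x^-1 * y \in (N : groupClosed G).

Lemma coset_rel_refl : reflexive coset_rel.
Proof. by move=> x; rewrite /coset_rel mulVg gpred1. Qed.

Lemma coset_rel_sym : symmetric coset_rel.
Proof. by move=> x y; rewrite /coset_rel -gpredV invgM invgK. Qed.

Lemma coset_rel_trans : transitive coset_rel.
Proof.
move=> y x z xy yz; rewrite /coset_rel.
have -> : x^-1 * z = (x^-1 * y) * (y^-1 * z) by rewrite mulgA mulgK.
exact: gpredM.
Qed.

Canonical coset_equiv := EquivRel coset_rel coset_rel_refl coset_rel_sym
  coset_rel_trans.

Definition quotient_group := {eq_quot coset_rel}.
HB.instance Definition _ := EqQuotient.on quotient_group.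
HB.instance Definition _ := Choice.on quotient_group.

Definition coset_class (x : G) : quotient_group := \pi x.

Lemma coset_classP x y : coset_class x = coset_class y <-> coset_rel x y.
Proof. by split=> [/eqmodP|h] //; apply/eqmodP. Qed.

Lemma coset_reprK (x : quotient_group) : coset_class (repr x) = x.
Proof. exact: reprK. Qed.

Lemma coset_rel_repr x : coset_rel (repr (coset_class x)) x.
Proof. by apply/coset_classP; rewrite coset_reprK. Qed.

Lemma coset_relM x x' y y' :
  coset_rel x x' -> coset_rel y y' -> coset_rel (x * y) (x' * y').
Proof.
move=> xx' yy'; rewrite /coset_rel.
have -> : (x * y)^-1 * (x' * y') = (x^-1 * x') ^ y * (y^-1 * y').
  by rewrite conjgE invgM !mulgA mulgK.
by rewrite gpredM // normal_conj.
Qed.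

Definition quotient_one : quotient_group := coset_class 1.
Definition quotient_mul (x y : quotient_group) : quotient_group :=
  coset_class (repr x * repr y).
Definition quotient_inv (x : quotient_group) : quotient_group :=
  coset_class (repr x)^-1.

Lemma quotient_mulA : associative quotient_mul.
Proof.
move=> x y z; apply/coset_classP.
apply: (@coset_rel_trans (repr x * (repr y * repr z))).
  exact: (coset_relM (coset_rel_refl _) (coset_rel_repr _)).
rewrite mulgA coset_rel_sym.
exact: (coset_relM (coset_rel_repr _) (coset_rel_refl _)).
Qed.

Lemma quotient_mul1 : left_id quotient_one quotient_mul.
Proof.
move=> x; rewrite -[RHS]coset_reprK; apply/coset_classP.
rewrite -[X in coset_rel _ X]mul1g.
exact: (coset_relM (coset_rel_repr _) (coset_rel_refl _)).
Qed.

Lemma quotient_mulr1 : right_id quotient_one quotient_mul.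
Proof.
move=> x; rewrite -[RHS]coset_reprK; apply/coset_classP.
rewrite -[X in coset_rel _ X]mulg1.
exact: (coset_relM (coset_rel_refl _) (coset_rel_repr _)).
Qed.

Lemma quotient_mulV : left_inverse quotient_one quotient_inv quotient_mul.
Proof.
move=> x; apply/coset_classP; rewrite -(mulVg (repr x)).
exact: (coset_relM (coset_rel_repr _) (coset_rel_refl _)).
Qed.

Lemma quotient_mulrV : right_inverse quotient_one quotient_inv quotient_mul.
Proof.
move=> x; apply/coset_classP; rewrite -(mulgV (repr x)).
exact: (coset_relM (coset_rel_refl _) (coset_rel_repr _)).
Qed.

HB.instance Definition _ := isGroup.Build quotient_group
  quotient_mulA quotient_mul1 quotient_mulr1 quotient_mulV quotient_mulrV.

End Quotient.

Definition isomorphic (G H : groupType) :=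
  exists f : {multiplicative G -> H}, bijective f.

Definition commensurable_up_to_finite_kernels (H1 H2 : groupType) :=
  exists (S1 : groupClosed H1) (S2 : groupClosed H2)
         (F1 : normal_subgroup (subgroup S1))
         (F2 : normal_subgroup (subgroup S2)),
    [/\ finite_index S1, finite_index S2,
        finite_set [set` (F1 : groupClosed _)],
        finite_set [set` (F2 : groupClosed _)] &
        isomorphic (quotient_group F1) (quotient_group F2)].

(* T is Borel isomorphic to a Polish space: the completeness of P is the one of
   its (pseudo)metric uniformity, and the Hausdorff property makes the
   pseudometric a metric. *)
Definition standard_borel (R : realType) d (T : measurableType d) :=
  exists (P : completePseudoMetricType R) (f : T -> P),
    [/\ hausdorff_space P,
        exists2 D : set P, countable D & dense D,
        bijective f &
        forall B : set P, <<s @open P >> B <-> measurable (f @^-1` B)].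

Section Action.
Context (R : realType) d (T : measurableType d) (mu : {measure set T -> \bar R}).

Definition is_action (K : groupType) (a : K -> T -> T) :=
  (forall x, a 1 x = x) /\ (forall g h x, a (g * h) x = a g (a h x)).

(* The maps a g and a g^-1 are mutually inverse, so that the measurability of
   all the a g makes them Borel automorphisms. *)
Definition measure_preserving_action (K : groupType) (a : K -> T -> T) :=
  [/\ is_action a,
      forall g, measurable_fun setT (a g) &
      forall g A, measurable A -> mu (a g @^-1` A) = mu A].

Definition essentially_free (K : groupType) (a : K -> T -> T) :=
  {ae mu, forall x, forall g, a g x = x -> g = 1}.

Definition fundamental_domain (K : groupType) (a : K -> T -> T) (X : set T) :=
  [/\ measurable X,
      {ae mu, forall x, exists g, (a g @` X) x} &
      forall g h, g <> h -> mu.-negligible (a g @` X `&` a h @` X)].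

End Action.

Definition measure_equivalent (R : realType) (G H : groupType) :=
  exists (d : measure_display) (T : measurableType d)
         (mu : {measure set T -> \bar R}) (a : G * H -> T -> T),
    let aG (g : G) := a (g, 1) in
    let aH (h : H) := a (1, h) in
    [/\ standard_borel R T, sigma_finite setT mu, mu setT <> 0%E &
        measure_preserving_action mu a] /\
    [/\ essentially_free mu aG, essentially_free mu aH,
        exists2 X, fundamental_domain mu aG X & (mu X < +oo)%E &
        exists2 Y, fundamental_domain mu aH Y & (mu Y < +oo)%E].

(* Main.v *)
(* Replace the infinite cyclic vertex group of the RAAG G at one vertex v0 by a
   torsion group D / Z, where Z <= D <= Q; call H the resulting graph product.
   D / Z acts on [0, 1[ by rational rotations, and the odometer attached to an
   exhaustion of D by the (1 / P_n) Z gives an action of Z with the same orbits.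
   Letting H act on [0, 1[ through D / Z and G through Z, the orbit
   equivalence cocycles between D / Z and Z extend to cocycles H -> G and
   G -> H that are inverse to each other: this need only be checked on
   generators.  Hence [0, 1[ * {1} is a fundamental domain for both groups in
   [0, 1[ * G, which is identified with the real line, where everything acts by
   piecewise rational translations.
   The q-torsion of H is controlled in the same way: an element of prime
   order q acts trivially on [0, 1[ if D / Z has no q-torsion, so that its
   cocycle is a torsion element of G, which is torsion-free.  The set of the
   primes q for which D / Z contains all the 1 / q^n is therefore an invariant
   of commensurability up to finite kernels. *)
Require Import Defs.
From HB Require Import structures.
From mathcomp Require Import all_boot all_order all_algebra.
From mathcomp Require Import all_classical all_reals all_analysis.
From mathcomp Require Import measurable_realfun zify ring lra.

Set Implicit Arguments.
Unset Strict Implicit.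
Unset Printing Implicit Defensive.

Import Order.TTheory GRing.Theory Num.Theory.

(** * Groups given by generators and relators, and their skew products *)

Section PresentedGroupFacts.
Local Open Scope group_scope.
Variables (V : choiceType) (rels : set (word V)).
Implicit Types (w : word V) (x y : presented rels).

(** No normal forms in graph products are used: everything about [G] and [H] is extracted from skew
    products. A letter acts on [X * Q] by a map of [X] and a left multiplication in [Q] depending on
    the point, and one has to see that the relators act trivially. A relator [v0, w] does, because w
    fixes [X] pointwise and commutes with all powers of v0, or with all of D / Z: this is why
    cocycles of the vertex group extend. The same device shows that [G] is torsion-free: when a
    vertex is killed, its conjugates are recorded by a cocycle with values in a free group. The
    cocycles are to be inverse to each other at every point, not almost everywhere. The odometer
    adds one with carry to the mixed radix digits of a point of [0, 1[, read as the digits of an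
    adic integer. On the orbit of 0, where expansions terminate, this yields only the nonnegative
    integers instead of all integers; that orbit is countable, so an arbitrary numbering of it by
    the integers can be used without harm to measurability. *)

Definition presented_gen (v : V) : presented rels :=
  presented_class rels [:: (v, false)].

Lemma presented_class1 : presented_class rels [::] = 1.
Proof. by []. Qed.

Lemma presented_classM w1 w2 :
  presented_class rels (w1 ++ w2)
  = presented_class rels w1 * presented_class rels w2.
Proof.
by apply/presented_classP/WordCat; apply: WordSym; exact: word_eq_repr.
Qed.

Lemma presented_class_letter (v : V) b :
  presented_class rels [:: (v, b)]
  = if b then (presented_gen v)^-1 else presented_gen v.
Proof.
case: b => //; apply: esym; apply: mulg1_eq; rewrite -presented_classM /=.
by apply/presented_classP; exact: (WordCancel _ v false).
Qed.

Lemma presented_class_cons (v : V) b w :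
  presented_class rels ((v, b) :: w)
  = (if b then (presented_gen v)^-1 else presented_gen v)
    * presented_class rels w.
Proof. by rewrite -cat1s presented_classM presented_class_letter. Qed.

Lemma presented_ind (P : presented rels -> Prop) :
  P 1 -> (forall x y, P x -> P y -> P (x * y)) -> (forall x, P x -> P x^-1) ->
  (forall v, P (presented_gen v)) -> forall x, P x.
Proof.
move=> P1 PM PV Pg x; rewrite -(presented_reprK x).
elim: (repr x) => [|[v b] w ih]; first by rewrite presented_class1.
rewrite presented_class_cons; apply: PM => //.
by case: b; [apply: PV|]; exact: Pg.
Qed.

Lemma countable_presented : countable [set: V] ->
  countable [set: presented rels].
Proof.
move=> /countable_injP[f fi].
apply/countable_injP; exists (fun x => pickle [seq (f l.1, l.2) | l <- repr x]).
move=> x y _ _ /(pcan_inj pickleK) h; rewrite -(presented_reprK x).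
rewrite -(presented_reprK y); congr presented_class.
apply: (inj_map _ h) => -[v b] [v' b'] [fE ->]; congr (_, _).
by apply: fi fE; rewrite in_setT.
Qed.

Section Action.
Variables (T : Type) (f : V * bool -> T -> T).
Hypothesis fK : forall v b t, f (v, b) (f (v, ~~ b) t) = t.
Hypothesis frel : forall w t, rels w -> foldr f t w = t.

Definition presented_act x (t : T) := foldr f t (repr x).

Lemma foldr_word_eq w1 w2 t : word_eq rels w1 w2 -> foldr f t w1 = foldr f t w2.
Proof.
move=> h; elim: h t => //=.
- by move=> ? ? ? _ ih1 _ ih2 t; rewrite ih1 ih2.
- by move=> ? ? ? ? _ ih1 _ ih2 t; rewrite !foldr_cat ih2 ih1.
- by move=> ? ? t; exact: frel.
Qed.

Lemma presented_act_class w t :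
  presented_act (presented_class rels w) t = foldr f t w.
Proof. exact/foldr_word_eq/word_eq_repr. Qed.

Lemma presented_act1 t : presented_act 1 t = t.
Proof. exact: presented_act_class. Qed.

Lemma presented_actM x y t :
  presented_act (x * y) t = presented_act x (presented_act y t).
Proof. by rewrite presented_act_class foldr_cat. Qed.

Lemma presented_act_gen v t :
  presented_act (presented_gen v) t = f (v, false) t.
Proof. exact: presented_act_class. Qed.

End Action.

Section Skew.
Variables (X : Type) (Q : groupType) (s s' : V -> X -> X) (u : V -> X -> Q).
Hypothesis sK : forall v, cancel (s v) (s' v).
Hypothesis s'K : forall v, cancel (s' v) (s v).

(** For an inverse letter the cocycle is read at the point reached, which makes the two letters
    mutually inverse on [X * Q]. *)
Definition skew_letter (l : V * bool) (xq : X * Q) : X * Q :=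
  if l.2 then (s' l.1 xq.1, (u l.1 (s' l.1 xq.1))^-1 * xq.2)
  else (s l.1 xq.1, u l.1 xq.1 * xq.2).

Lemma skew_letterK v b t : skew_letter (v, b) (skew_letter (v, ~~ b) t) = t.
Proof.
case: t => x q; case: b; rewrite /skew_letter /=; first by rewrite sK mulKg.
by rewrite s'K mulVKg.
Qed.

Lemma skew_commutator v1 v2 t :
  (forall p, s v1 (s v2 p) = s v2 (s v1 p)) ->
  (forall p, u v1 (s v2 p) * u v2 p = u v2 (s v1 p) * u v1 p) ->
  foldr skew_letter t [:: (v1, true); (v2, true); (v1, false); (v2, false)] = t.
Proof.
move=> hs hu; rewrite [foldr _ _ _]/=.
have -> : skew_letter (v1, false) (skew_letter (v2, false) t)
        = skew_letter (v2, false) (skew_letter (v1, false) t).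
  by rewrite /skew_letter /= hs !mulgA hu.
by rewrite (skew_letterK v2 true) (skew_letterK v1 true).
Qed.

Hypothesis srel : forall w t, rels w -> foldr skew_letter t w = t.

Definition skew_base x (p : X) : X := (presented_act skew_letter x (p, 1)).1.
Definition skew_cocycle x (p : X) : Q := (presented_act skew_letter x (p, 1)).2.

Let aM := presented_actM skew_letterK srel.
Let a1 := presented_act1 skew_letterK srel.
Let ag := presented_act_gen skew_letterK srel.

(** Letters multiply [Q] on the left, hence commute with right multiplications: the values at the
    points [(p, 1)] determine the whole action. *)
Lemma skew_actE x p q :
  presented_act skew_letter x (p, q) = (skew_base x p, skew_cocycle x p * q).
Proof.
rewrite /skew_base /skew_cocycle /presented_act.
elim: (repr x) => [|[v b] w ih] /=; first by rewrite mul1g.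
by rewrite ih /skew_letter /=; case: b; rewrite /= ?mulgA.
Qed.

Lemma skew_base1 p : skew_base 1 p = p.
Proof. by rewrite /skew_base a1. Qed.

Lemma skew_baseM x y p : skew_base (x * y) p = skew_base x (skew_base y p).
Proof. by rewrite {1}/skew_base aM !skew_actE. Qed.

Lemma skew_cocycle1 p : skew_cocycle 1 p = 1.
Proof. by rewrite /skew_cocycle a1. Qed.

Lemma skew_cocycleM x y p :
  skew_cocycle (x * y) p = skew_cocycle x (skew_base y p) * skew_cocycle y p.
Proof. by rewrite {1}/skew_cocycle aM !skew_actE mulg1. Qed.

Lemma skew_base_gen v p : skew_base (presented_gen v) p = s v p.
Proof. by rewrite /skew_base ag. Qed.

Lemma skew_cocycle_gen v p : skew_cocycle (presented_gen v) p = u v p.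
Proof. by rewrite /skew_cocycle ag /skew_letter /= mulg1. Qed.

End Skew.

End PresentedGroupFacts.

(** * Free groups are torsion-free *)

Section FreeGroup.
Local Open Scope group_scope.
Variable V : choiceType.
Implicit Types (l : V * bool) (w : word V).

Definition free_group := presented (set0 : set (word V)).

Definition letter_inv l := (l.1, ~~ l.2).

Lemma letter_invK : involutive letter_inv.
Proof. by case=> v b; rewrite /letter_inv /= negbK. Qed.

Definition noncancelling l l' := l' != letter_inv l.

Definition push l w : word V :=
  if w is m :: w' then if m == letter_inv l then w' else l :: w else [:: l].

Lemma push_reduced l w :
  sorted noncancelling w -> sorted noncancelling (push l w).
Proof.
case: w => //= m w h; case: eqP => [_|/eqP ne] /=; first exact: path_sorted h.
by rewrite h /noncancelling ne.
Qed.

Lemma pushK l w : sorted noncancelling w -> push l (push (letter_inv l) w) = w.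
Proof.
case: w => [|m w] /=; first by rewrite eqxx.
rewrite letter_invK; case: eqP => [->|_ _] /=; last by rewrite eqxx.
case: w => //= n w /andP[]; rewrite /noncancelling /=.
by move=> /negbTE ->.
Qed.

Definition reduced_word := {w : word V | sorted noncancelling w}.

Definition free_push l (t : reduced_word) : reduced_word :=
  exist _ (push l (sval t)) (push_reduced l (svalP t)).

(** Van der Waerden's argument: the free group acts on reduced words by [push], and the class of a
    reduced word [w] sends the empty word to [w]. *)
Lemma free_class_reduced w1 w2 :
  sorted noncancelling w1 -> sorted noncancelling w2 ->
  presented_class set0 w1 = presented_class set0 w2 -> w1 = w2.
Proof.
have key w : sorted noncancelling w ->
    sval (foldr free_push (exist _ [::] isT : reduced_word) w) = w.
  elim: w => //= l w ih h; rewrite ih; last exact: path_sorted h.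
  by case: w h {ih} => //= m w /andP[/negbTE ->].
move=> h1 h2 /presented_classP h; rewrite -(key _ h1) -(key _ h2).
congr sval; apply: (@foldr_word_eq _ set0 _ free_push _ _ _ _ _ h) => //.
move=> v b t; apply: val_inj => /=; exact: (@pushK (v, b)) (svalP t).
Qed.

(** Induction on the length. The n-fold concatenation of a nonempty cyclically reduced word is
    reduced and nonempty; otherwise, conjugating by the last letter removes both end letters. *)
Lemma free_class_reduced_torsion n w : (0 < n)%N -> sorted noncancelling w ->
  presented_class set0 w ^+ n = 1 -> w = [::].
Proof.
move=> n0; have [k] := ubnP (size w); elim: k w => // k ih [//|l w] szw red wn.
have [cyc|] := boolP (noncancelling (last l w) l).
  have pw m : path noncancelling (last l w) (flatten (nseq m (l :: w))).
    elim: m => //= m ihm; rewrite cat_path cyc /=.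
    by move: red => /= ->.
  have red' : sorted noncancelling (flatten (nseq n (l :: w))).
    exact: path_sorted (pw n).
  have clE : presented_class set0 (flatten (nseq n (l :: w))) = 1.
    rewrite -wn; elim: (n) => // m ihm.
    by rewrite [flatten _]/= -cat_cons presented_classM ihm expgS.
  by move: n0; case: (n) (free_class_reduced red' (isT : sorted _ [::]) clE).
rewrite negbK => /eqP lE.
case/lastP: w => [|u m] in lE red wn szw *.
  by case: l lE {red wn szw} => v [] [].
rewrite last_rcons in lE.
have clE : presented_class set0 (l :: rcons u m)
    = presented_class set0 u ^ presented_class set0 [:: m].
  rewrite -cats1 -(cat1s l) !presented_classM conjgE; congr (_ * _).
  rewrite lE; case: (m) => v b /=; rewrite !presented_class_letter.
  by case: b => //=; rewrite invgK.
have : presented_class set0 u ^+ n = 1.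
  by apply: (@conjg_inj _ (presented_class set0 [:: m]));
    rewrite conj1g conjXg -clE.
move=> /ih uE; have {uE} u0 : u = [::].
  apply: uE; first by move: szw; rewrite /= size_rcons; lia.
  by move: red; rewrite /= rcons_path => /andP[/path_sorted].
(* An empty [u] leaves two letters that cancel each other. *)
move: red; rewrite u0 /= andbT.
by rewrite /noncancelling lE letter_invK eqxx.
Qed.

Lemma free_group_torsion_free (x : free_group) n :
  (0 < n)%N -> x ^+ n = 1 -> x = 1.
Proof.
have [w red <-] : exists2 w, sorted noncancelling w & presented_class set0 w
  = x.
  rewrite -(presented_reprK x); elim: (repr x) => [|l w [w' red' wE]].
    by exists [::].
  exists (push l w'); first exact: push_reduced.
  rewrite -cat1s presented_classM -wE -presented_classM.
  case: w' {red' wE} => //= m w'; case: eqP => // ->.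
  rewrite -[l :: letter_inv l :: _]/([:: l; letter_inv l] ++ w')
    presented_classM.
  apply/esym; rewrite -[RHS]mul1g; congr (_ * _).
  by apply/presented_classP; case: l => v b; exact: WordCancel.
by move=> n0 xn; rewrite (free_class_reduced_torsion n0 red xn).
Qed.

End FreeGroup.

(** * Right-angled Artin groups are torsion-free *)

Section RaagTorsion.
Local Open Scope group_scope.
Variables (V : finType) (e : rel V).

Let G := raag e.
Let gen : V -> G := @presented_gen V (raag_relators e).

Lemma raag_gen_comm v w : e v w -> gen v * gen w = gen w * gen v.
Proof.
move=> evw; apply/commgP/eqP.
have : presented_class (raag_relators e)
    [:: (v, true); (w, true); (v, false); (w, false)] = 1.
  by apply/presented_classP; apply: WordRel; exists v, w.
by rewrite !presented_class_cons presented_class1 mulg1.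
Qed.

Section KillVertex.
Variable v : V.

Let fgen : G -> free_group G := @presented_gen G set0.

(** The base action is left translation through the retraction that kills [v]. Each time [v] is read
    at [g], the cocycle emits a free letter for the conjugate [gen v ^ g]; labelling these letters
    by elements of [G] identifies equal conjugates, as the relators between [v] and its neighbours
    require. *)
Let s w (g : G) := if w == v then g else gen w * g.
Let s' w (g : G) := if w == v then g else (gen w)^-1 * g.
Let u w (g : G) := if w == v then fgen (gen v ^ g) else 1.

Let sK w : cancel (s w) (s' w).
Proof. by move=> g; rewrite /s /s'; case: eqP => // _; rewrite mulKg. Qed.

Let s'K w : cancel (s' w) (s w).
Proof. by move=> g; rewrite /s /s'; case: eqP => // _; rewrite mulVKg. Qed.

Let srel w t : raag_relators e w -> foldr (skew_letter s s' u) t w = t.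
Proof.
case=> a [b [eab ->]]; apply: skew_commutator => // g.
  rewrite /s; case: eqP => // _; case: eqP => // _.
  by rewrite !mulgA raag_gen_comm.
have fix_conj c : e c v \/ e v c -> gen v ^ gen c = gen v.
  move=> h; rewrite conjgE; apply: (mulgI (gen c)); rewrite mulVKg.
  by case: h => /raag_gen_comm ->.
rewrite /u /s; have [av|av] := eqVneq a v; have [bv|bv] := eqVneq b v => //.
- by rewrite mulg1 mul1g conjgM fix_conj //; right; rewrite -av.
- by rewrite mulg1 mul1g conjgM fix_conj //; left; rewrite -bv.
Qed.

Let base := @skew_base V (raag_relators e) G (free_group G) s s' u.
Let cocycle := @skew_cocycle V (raag_relators e) G (free_group G) s s' u.

Let base_class w g :
  base (presented_class _ w) g
  = presented_class _ [seq l <- w | l.1 != v] * g.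
Proof.
elim: w => [|[a b] w ih]; first by rewrite [LHS](skew_base1 sK s'K srel) mul1g.
rewrite -cat1s presented_classM [LHS](skew_baseM sK s'K srel) -/base ih.
rewrite filter_cat presented_classM -mulgA /base /skew_base.
rewrite (presented_act_class (skew_letterK _ sK s'K) srel) /= /skew_letter /s
  /s' /=.
case: (eqVneq a v) => [_|av] /=.
  by rewrite presented_class1 mul1g; case: b.
by rewrite presented_class_letter; case: b.
Qed.

Let eval_letter (l : G * bool) (q : G) := (if l.2 then l.1^-1 else l.1) * q.

Let eval_letterK g b q : eval_letter (g, b) (eval_letter (g, ~~ b) q) = q.
Proof. by case: b; rewrite /eval_letter /= ?mulKg ?mulVKg. Qed.

Let eval (f : free_group G) := presented_act eval_letter f 1.

Let evalM g f : eval (fgen g * f) = g * eval f.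
Proof. by rewrite /eval presented_actM // presented_act_gen. Qed.

(** The map sending [(g, f)] to [g * eval f] intertwines the skew action with left multiplication on
    [G], so base and cocycle together recover [x]. *)
Let eval_act x g f :
  base x g * eval (cocycle x g * f) = x * (g * eval f).
Proof.
elim/presented_ind: x g f => [g f|x y ihx ihy g f|x ih g f|w g f].
- by rewrite /base /cocycle skew_base1 ?skew_cocycle1 ?mul1g.
- rewrite /base /cocycle skew_baseM ?skew_cocycleM // -mulgA -/cocycle -/base.
  by rewrite ihx ihy !mulgA.
- have gE : base x (base x^-1 g) = g.
    by rewrite -[LHS](skew_baseM sK s'K srel) mulgV
      [LHS](skew_base1 sK s'K srel).
  have := ih (base x^-1 g) (cocycle x^-1 g * f); rewrite gE mulgA.
  rewrite -[cocycle x _ * _](skew_cocycleM sK s'K srel) mulgV.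
  rewrite [skew_cocycle _ _ _ _ _](skew_cocycle1 sK s'K srel) mul1g => ->.
  by rewrite mulKg.
- rewrite /base /cocycle skew_base_gen ?skew_cocycle_gen // /s /u.
  case: eqP => [->|_]; last by rewrite mul1g mulgA.
  by rewrite evalM conjgE -!mulgA mulVKg.
Qed.

(** When the retraction kills the element, its powers fix the base and the cocycle is multiplicative
    along them. Its value is then torsion in a free group, hence trivial, and [eval_act]
    concludes. *)
Lemma raag_torsion_kill_vertex w n : (0 < n)%N ->
  presented_class (raag_relators e) w ^+ n = 1 ->
  (presented_class (raag_relators e) [seq l <- w | l.1 != v] ^+ n = 1 ->
   presented_class (raag_relators e) [seq l <- w | l.1 != v] = 1) ->
  presented_class (raag_relators e) w = 1.
Proof.
set x := presented_class _ w; set y := presented_class _ _ => n0 xn yP.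
have bE m g : base (x ^+ m) g = y ^+ m * g.
  elim: m => [|m ih]; first by rewrite !expg0 mul1g
    [LHS](skew_base1 sK s'K srel).
  rewrite !expgS [LHS](skew_baseM sK s'K srel) -/base ih.
  by rewrite base_class -/y mulgA.
have y1 : y = 1.
  by apply: yP; have := bE n 1; rewrite xn mulg1 [LHS](skew_base1 sK s'K srel).
have b1 m g : base (x ^+ m) g = g by rewrite bE y1 expg1n mul1g.
have cE m : cocycle (x ^+ m) 1 = cocycle x 1 ^+ m.
  elim: m => [|m ih]; first by rewrite [LHS](skew_cocycle1 sK s'K srel).
  by rewrite !expgS [LHS](skew_cocycleM sK s'K srel) -/base -/cocycle b1 ih.
have c1 : cocycle x 1 = 1.
  apply: (free_group_torsion_free n0); rewrite -cE xn.
  by rewrite [LHS](skew_cocycle1 sK s'K srel).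
have := eval_act x 1 1; rewrite c1 mul1g -[x in base x]expg1 b1.
rewrite !mul1g => h; apply: (mulIg (eval 1)).
by rewrite -h mul1g.
Qed.

End KillVertex.

Lemma raag_torsion_free (x : G) n : (0 < n)%N -> x ^+ n = 1 -> x = 1.
Proof.
move=> n0; rewrite -(presented_reprK x); move: (repr x) => w.
(* Induction on a list containing the vertices of the word: the retraction erases letters, so it
   stays among words over the remaining vertices. *)
suff key (s : seq V) : {in [pred w | all (fun l => l.1 \in s) w],
    forall w, presented_class (raag_relators e) w ^+ n = 1 ->
    presented_class (raag_relators e) w = 1}.
  by apply: (key (enum V)); rewrite inE; apply/allP => l _; rewrite mem_enum.
elim: s => [|v s ih] {}w; rewrite inE.
  by case: w => //= _ _; exact: presented_class1.
move=> ws wn; apply: (raag_torsion_kill_vertex (v := v) n0 wn) => wn'.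
apply: ih wn'; rewrite inE; apply/allP => l; rewrite mem_filter => /andP[lv lw].
by move/allP: ws => /(_ _ lw); rewrite inE (negbTE lv).
Qed.

End RaagTorsion.

(** * Integer powers *)

Section Zexp.
Local Open Scope group_scope.
Variable G : groupType.
Implicit Types (g h : G) (a b : int).

Definition zexp g a : G :=
  match a with Posz n => g ^+ n | Negz n => g ^- n.+1 end.

Lemma zexp1 g : zexp g 1%R = g. Proof. by []. Qed.

Lemma zexpN g a : zexp g (- a)%R = (zexp g a)^-1.
Proof.
case: a => [[|n]|n] /=; first by rewrite invg1.
  by [].
by rewrite invgK.
Qed.

Lemma zexpS g a : zexp g (1 + a)%R = g * zexp g a.
Proof.
case: a => [n|[|n]]; first by rewrite -PoszD add1n /= expgS.
  by rewrite /= expg1 mulgV.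
have -> : (1 + Negz n.+1)%R = Negz n by rewrite !NegzE; lia.
by rewrite /= (expgSr g n.+1) invgM mulVKg.
Qed.

Lemma zexpD g a b : zexp g (a + b)%R = zexp g a * zexp g b.
Proof.
have zexpB c : zexp g (- 1 + c)%R = g^-1 * zexp g c.
  by apply: (mulgI g); rewrite -zexpS addrA subrr add0r mulVKg.
elim/int_rect: a => [|n ih|n ih]; first by rewrite add0r mul1g.
  by rewrite -add1n PoszD -addrA !zexpS ih mulgA.
by rewrite -add1n PoszD opprD -addrA !zexpB ih mulgA.
Qed.

Lemma zexp_comm g h a : h * g = g * h -> h * zexp g a = zexp g a * h.
Proof.
move=> hg; case: a => n /=; first exact: commuteX.
by apply: commuteV; exact: commuteX.
Qed.

End Zexp.

(** * Mutually inverse cocycles *)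

Section CocycleInverse.
Local Open Scope group_scope.
Variable X : Type.

Definition is_cocycle (G Q : groupType) (b : G -> X -> X) (C : G -> X -> Q) :=
  [/\ forall x, b 1 x = x, forall g h x, b (g * h) x = b g (b h x) &
      forall g h x, C (g * h) x = C g (b h x) * C h x].

Variables (G H : groupType) (bG : G -> X -> X) (bH : H -> X -> X).
Variables (E : G -> X -> H) (C : H -> X -> G).

Lemma is_cocycle1 : is_cocycle bG E -> forall x, E 1 x = 1.
Proof.
move=> [b1 _ EM] x; have := EM 1 1 x; rewrite mulg1 b1 -[LHS]mul1g.
by move/mulIg.
Qed.

Lemma is_cocycleV : is_cocycle bG E ->
  forall g x, E g^-1 (bG g x) = (E g x)^-1.
Proof.
move=> cE g x; have [_ _ EM] := cE; apply: invg_inj; rewrite invgK.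
by apply: mulg1_eq; rewrite -EM mulVg is_cocycle1.
Qed.

Lemma is_cocycle_baseV : is_cocycle bG E ->
  forall g x y, bG g x = y -> bG g^-1 y = x.
Proof. by move=> [b1 bM _] g x _ <-; rewrite -bM mulVg b1. Qed.

(** Required at all [x] for a single [h]: a product moves the point, and with this quantifier the
    good [h] form a subgroup. *)
Definition cocycle_inverse_at (h : H) :=
  forall x, bG (C h x) x = bH h x /\ E (C h x) x = h.

End CocycleInverse.

Section CocycleInverseClosed.
Local Open Scope group_scope.
Variables (X : Type) (G H : groupType) (bG : G -> X -> X) (bH : H -> X -> X).
Variables (E : G -> X -> H) (C : H -> X -> G).
Hypotheses (cE : is_cocycle bG E) (cC : is_cocycle bH C).
Let invat := cocycle_inverse_at bG bH E C.

Lemma cocycle_inverse_at1 : invat 1.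
Proof.
move=> x; have [b1 _ _] := cE; have [b1' _ _] := cC.
by rewrite (is_cocycle1 cC) b1 b1' (is_cocycle1 cE); split.
Qed.

Lemma cocycle_inverse_atM h h' : invat h -> invat h' -> invat (h * h').
Proof.
move=> Ph Ph' x; have [_ bM EM] := cE; have [_ bM' CM] := cC.
have [b2 e2] := Ph' x; have [b1 e1] := Ph (bH h' x).
by rewrite CM bM EM b2 e2 b1 e1 bM'; split.
Qed.

Lemma cocycle_inverse_atV h : invat h -> invat h^-1.
Proof.
move=> Ph x; have [b1 bM EM] := cE; have [b1' bM' CM] := cC.
have xE : bH h (bH h^-1 x) = x by rewrite -bM' mulgV b1'.
have [] := Ph (bH h^-1 x); rewrite xE => bE eE.
have -> : C h^-1 x = (C h (bH h^-1 x))^-1 by rewrite -(is_cocycleV cC) xE.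
split; first by rewrite (is_cocycle_baseV cE bE).
by rewrite -{2}bE (is_cocycleV cE) eE.
Qed.

End CocycleInverseClosed.

(* The graph product over (V, e) in which the vertex group at v0 is D / Z and
   all the other vertex groups are infinite cyclic: the letter inr r stands for
   the class of r in D / Z. *)
Inductive twisted_relators (V : finType) (e : rel V) (v0 : V) (D : pred rat) :
    word (V + rat)%type -> Prop :=
| TwKill : twisted_relators e v0 D [:: (inl v0, false)]
| TwComm u w : e u w -> twisted_relators e v0 D
    [:: (inl u, true); (inl w, true); (inl u, false); (inl w, false)]
| TwCommRat r w : D r -> e v0 w -> twisted_relators e v0 D
    [:: (inr r, true); (inl w, true); (inr r, false); (inl w, false)]
| TwAdd r s : D r -> D s -> twisted_relators e v0 D
    [:: (inr (r + s)%R, true); (inr r, false); (inr s, false)]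
| TwOne : twisted_relators e v0 D [:: (inr 1%R, false)]
| TwOut r : ~~ D r -> twisted_relators e v0 D [:: (inr r, false)].

Definition twisted_raag (V : finType) (e : rel V) (v0 : V) (D : pred rat) :
  groupType := presented (twisted_relators e v0 D : set (word (V + rat)%type)).

Record rat_subgroup (D : pred rat) : Prop := RatSubgroup {
  rat_subgroup1 : D 1%R;
  rat_subgroupD : forall r s, D r -> D s -> D (r + s)%R;
  rat_subgroupN : forall r, D r -> D (- r)%R }.

(* A free action rot of D / Z on X together with a cocycle c which, at every
   point x, induces a bijection between D / Z and the integers; such a c amounts
   to a free action of the integers with the same orbits. *)
Record orbit_cocycle (D : pred rat) (X : Type) (rot : rat -> X -> X)
    (c : rat -> X -> int) : Prop := OrbitCocycle {
  rot_zero : forall x, rot 0%R x = x;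
  rot_one : forall x, rot 1%R x = x;
  rot_add : forall r s x, rot (r + s)%R x = rot r (rot s x);
  rot_free : forall r x, rot r x = x -> r \is a Num.int;
  cocycle_one : forall x, c 1%R x = 0%R;
  cocycle_add : forall r s x, D r -> D s ->
    c (r + s)%R x = (c r (rot s x) + c s x)%R;
  cocycle_inj : forall r x, D r -> c r x = 0%R -> r \is a Num.int;
  cocycle_surj : forall x k, exists2 r, D r & c r x = k }.

(** * Cocycles between the graph product and the Artin group *)

Section Coupling.
Local Open Scope group_scope.
Variables (V : finType) (e : rel V) (e_sym : symmetric e) (v0 : V).
Hypothesis e_irr : irreflexive e.
Variable D : pred rat.
Hypothesis subD : rat_subgroup D.

Let D1 : D 1%R := rat_subgroup1 subD.
Let DD := rat_subgroupD subD.
Let DN := rat_subgroupN subD.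
Let G := raag e.
Let H := twisted_raag e v0 D.
Let gG : V -> G := @presented_gen V (raag_relators e).
Let gH (v : V) : H := presented_gen _ (inl v : (V + rat)%type).

(** Total on [rat]: the alphabet does not depend on [D], and [TwOut] makes the letters outside [D]
    trivial. *)
Definition twist (r : rat) : H := presented_gen _ (inr r : (V + rat)%type).

Let relH w : twisted_relators e v0 D w -> presented_class _ w = 1 :> H.
Proof. by move=> ?; apply/presented_classP; apply: WordRel. Qed.

Let gH_v0 : gH v0 = 1.
Proof. by apply: relH; exact: TwKill. Qed.

Let gH_comm u w : e u w -> gH u * gH w = gH w * gH u.
Proof.
move=> euw; apply/commgP/eqP; have := relH (TwComm v0 D euw).
by rewrite !presented_class_cons presented_class1 mulg1.
Qed.

Let twist_comm r w : e v0 w -> twist r * gH w = gH w * twist r.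
Proof.
move=> e0w; have [Dr|nDr] := boolP (D r); last first.
  by rewrite /twist [presented_gen _ _](relH (TwOut e v0 nDr)) mulg1 mul1g.
apply/commgP/eqP; have := relH (TwCommRat Dr e0w).
by rewrite !presented_class_cons presented_class1 mulg1.
Qed.

Lemma twistD r s : D r -> D s -> twist (r + s)%R = twist r * twist s.
Proof.
move=> Dr Ds; have := relH (TwAdd e v0 Dr Ds).
rewrite !presented_class_cons presented_class1 mulg1.
by move/mulg1_eq; rewrite invgK.
Qed.

Let D0 : D 0%R. Proof. by rewrite -(subrr 1%R); apply/DD/DN. Qed.

Let int_closed (P : rat -> Prop) : P 0%R ->
  (forall r, D r -> P r -> P (1 + r)%R) ->
  (forall r, D r -> P r -> P (- r)%R) ->
  forall r, r \is a Num.int -> D r /\ P r.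
Proof.
move=> P0 PS PN.
have nP n : D n%:R%R /\ P n%:R%R.
  elim: n => [//|n [Dn Pn]]; rewrite -add1n natrD.
  by split; [exact: DD|exact: PS].
move=> _ /intrP[[n|n] ->]; first exact: nP.
rewrite NegzE mulrNz; have [Dn Pn] := nP n.+1.
by split; [exact: DN|exact: PN].
Qed.

Lemma D_int r : r \is a Num.int -> D r.
Proof. by move=> /(@int_closed xpredT)[]. Qed.

Lemma twist0 : twist 0%R = 1.
Proof. by apply: (mulgI (twist 0%R)); rewrite -twistD // addr0 mulg1. Qed.

Lemma twistN r : D r -> twist (- r)%R = (twist r)^-1.
Proof.
move=> Dr; apply/esym/mulg1_eq; rewrite -twistD //; last exact: DN.
by rewrite subrr twist0.
Qed.

Lemma twist_int r : r \is a Num.int -> twist r = 1.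
Proof.
have t1 : twist 1%R = 1 by apply: relH; exact: TwOne.
move=> /(@int_closed (fun s => twist s = 1))[] //; first exact: twist0.
  by move=> s Ds h; rewrite twistD // t1 h mulg1.
by move=> s Ds h; rewrite twistN // h invg1.
Qed.

Section Cocycle.
Variables (X : Type) (rot : rat -> X -> X) (c : rat -> X -> int).
Hypothesis cocycle_c : orbit_cocycle D rot c.

Let rot0 := rot_zero cocycle_c.
Let rot1 := rot_one cocycle_c.
Let rotD := rot_add cocycle_c.
Let rot_free := rot_free cocycle_c.
Let c1 := cocycle_one cocycle_c.
Let cD := cocycle_add cocycle_c.
Let c_inj := cocycle_inj cocycle_c.
Let c_surj := cocycle_surj cocycle_c.

Let rotK r : cancel (rot r) (rot (- r)%R).
Proof. by move=> x; rewrite -rotD addNr rot0. Qed.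

Let rotVK r : cancel (rot (- r)%R) (rot r).
Proof. by move=> x; rewrite -rotD subrr rot0. Qed.

Let rot_int r x : r \is a Num.int -> rot r x = x.
Proof.
move=> /(@int_closed (fun s => rot s x = x))[] // s _ h.
  by rewrite rotD h rot1.
by rewrite -{1}h rotK.
Qed.

Let c0 x : c 0%R x = 0%R.
Proof.
have := cD x D0 D0; rewrite addr0 rot0 => /eqP.
by rewrite -subr_eq0 opprD addrA subrr sub0r oppr_eq0 => /eqP.
Qed.

Let cN r x : D r -> c (- r)%R (rot r x) = (- c r x)%R.
Proof.
move=> Dr; apply/eqP; rewrite -addr_eq0 -cD //; last exact: DN.
by rewrite addNr c0.
Qed.

Let c_uniq r r' x : D r -> D r' -> c r x = c r' x -> (r - r')%R \is a Num.int.
Proof.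
move=> Dr Dr' crr'; have DNr' := DN Dr'.
apply: (@c_inj _ (rot r' x)); first exact: DD.
by rewrite cD // rotK cN // crr' subrr.
Qed.

Let rot_uniq r r' x : D r -> D r' -> c r x = c r' x -> rot r x = rot r' x.
Proof.
move=> Dr Dr' /(c_uniq Dr Dr') rr'.
by rewrite -{1}(subrK r' r) rotD rot_int.
Qed.

Let twist_uniq r r' x : D r -> D r' -> c r x = c r' x -> twist r = twist r'.
Proof.
move=> Dr Dr' /(c_uniq Dr Dr') rr'; have Drr' := D_int rr'.
by rewrite -{1}(subrK r' r) twistD // (twist_int rr') mul1g.
Qed.

(** Determined modulo the integers by [c_uniq]; neither [rot] nor [twist] sees the choice. *)
Definition rat_of_c k x : rat := sval (cid2 (c_surj x k)).

Let D_rat_of_c k x : D (rat_of_c k x).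
Proof. by rewrite /rat_of_c; case: cid2. Qed.

Let c_rat_of_c k x : c (rat_of_c k x) x = k.
Proof. by rewrite /rat_of_c; case: cid2. Qed.

Definition odometer k x := rot (rat_of_c k x) x.

Let odometerE r x : D r -> odometer (c r x) x = rot r x.
Proof. by move=> Dr; apply: rot_uniq => //; rewrite c_rat_of_c. Qed.

Let odometerK k : cancel (odometer k) (odometer (- k)%R).
Proof.
move=> x; set r := rat_of_c k x; have Dr : D r by exact: D_rat_of_c.
have -> : (- k)%R = c (- r)%R (rot r x) by rewrite cN // c_rat_of_c.
by rewrite odometerE ?rotK //; exact: DN.
Qed.

Let odometerVK k : cancel (odometer (- k)%R) (odometer k).
Proof. by move=> x; rewrite -{1}(opprK k) odometerK. Qed.

Let sH (l : (V + rat)%type) : X -> X :=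
  if l is inr r then (if D r then rot r else id) else id.
Let sH' (l : (V + rat)%type) : X -> X :=
  if l is inr r then (if D r then rot (- r)%R else id) else id.
Let uH (l : (V + rat)%type) (x : X) : G :=
  match l with
  | inl w => if w == v0 then 1 else gG w
  | inr r => if D r then zexp (gG v0) (c r x) else 1
  end.

Let sHK l : cancel (sH l) (sH' l).
Proof. by case: l => //= r; case: ifP. Qed.

Let sH'K l : cancel (sH' l) (sH l).
Proof. by case: l => //= r; case: ifP. Qed.

Let neq_v0 w : e v0 w -> (w == v0) = false.
Proof. by case: eqP => // ->; rewrite e_irr. Qed.

Let relH_act w t : twisted_relators e v0 D w ->
  foldr (skew_letter sH sH' uH) t w = t.
Proof.
case: t => x q; case=> [|u {}w euw|r {}w Dr e0w|r s Dr Ds||r nDr].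
- by rewrite /= /skew_letter /= eqxx mul1g.
- apply: skew_commutator => // p /=.
  by case: ifP => _; case: ifP => _; rewrite ?mulg1 ?mul1g //;
    exact: raag_gen_comm.
- apply: skew_commutator => //= p; rewrite Dr (neq_v0 e0w).
  by apply/esym/zexp_comm/raag_gen_comm; rewrite e_sym.
- have Drs : D (r + s)%R by exact: DD.
  (* By the cocycle relation the letters of [r] and [s] act together as the letter of [r + s], so
     that the relator becomes a letter followed by its inverse. *)
  have -> : foldr (skew_letter sH sH' uH) (x, q)
      [:: (inr (r + s)%R, true); (inr r, false); (inr s, false)]
    = skew_letter sH sH' uH (inr (r + s)%R, true)
        (skew_letter sH sH' uH (inr (r + s)%R, false) (x, q)).
    rewrite [LHS]/=; congr (skew_letter _ _ _ _ _).
    by rewrite /skew_letter /= Dr Ds Drs rotD cD // zexpD mulgA.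
  exact: (skew_letterK _ sHK sH'K (inr (r + s)%R) true).
- by rewrite /= /skew_letter /= D1 rot1 c1 mul1g.
- by rewrite /= /skew_letter /= (negbTE nDr) mul1g.
Qed.

Definition twisted_base : H -> X -> X := 
  @skew_base _ (twisted_relators e v0 D) X G sH sH' uH.
Definition twisted_cocycle : H -> X -> G :=
  @skew_cocycle _ (twisted_relators e v0 D) X G sH sH' uH.

Lemma twisted_is_cocycle : is_cocycle twisted_base twisted_cocycle.
Proof.
split=> [x|g h x|g h x]; first exact: skew_base1.
  exact: skew_baseM.
exact: skew_cocycleM.
Qed.

Let sG w : X -> X := if w == v0 then odometer 1%R else id.
Let sG' w : X -> X := if w == v0 then odometer (- 1)%R else id.
Let uG w x : H := if w == v0 then twist (rat_of_c 1%R x) else gH w.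

Let sGK w : cancel (sG w) (sG' w).
Proof. by rewrite /sG /sG'; case: ifP => // _; exact: odometerK. Qed.

Let sG'K w : cancel (sG' w) (sG w).
Proof. by rewrite /sG /sG'; case: ifP => // _; exact: odometerVK. Qed.

Let relG_act w t : raag_relators e w -> foldr (skew_letter sG sG' uG) t w = t.
Proof.
case=> a [b [eab ->]]; apply: skew_commutator => // x; rewrite /sG /uG.
  by case: ifP => _; case: ifP.
have [av|_] := eqVneq a v0; have [bv|_] := eqVneq b v0.
- by move: eab; rewrite av bv e_irr.
- by rewrite twist_comm // -av.
- by rewrite twist_comm // e_sym -bv.
- exact: gH_comm.
Qed.

Let baseG : G -> X -> X := @skew_base _ (raag_relators e) X H sG sG' uG.
Let cocycleG : G -> X -> H := @skew_cocycle _ (raag_relators e) X H sG sG' uG.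

Let cocycleGP : is_cocycle baseG cocycleG.
Proof.
split=> [x|g h x|g h x]; first exact: skew_base1.
  exact: skew_baseM.
exact: skew_cocycleM.
Qed.

(** The exponents for which this holds at every point are closed under sum and opposite, a sum being
    split at the intermediate point [rot s x]; so the exponent 1 suffices. *)
Let cocycleG_zexp k x r : D r -> c r x = k ->
  baseG (zexp (gG v0) k) x = rot r x /\ cocycleG (zexp (gG v0) k) x = twist r.
Proof.
have [b1 bM CM] := cocycleGP.
pose P k := forall x r, D r -> c r x = k ->
  baseG (zexp (gG v0) k) x = rot r x /\ cocycleG (zexp (gG v0) k) x = twist r.
have PD a b : P a -> P b -> P (a + b)%R.
  move=> Pa Pb {}x {}r Dr cr.
  set s := rat_of_c b x; have Ds : D s by exact: D_rat_of_c.
  have [bE tE] := Pb x s Ds (c_rat_of_c b x).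
  have Dt : D (r - s)%R by apply: DD => //; exact: DN.
  have [] := Pa (rot s x) (r - s)%R Dt.
    rewrite cD //; last exact: DN.
    by rewrite rotK cN // cr c_rat_of_c addrK.
  rewrite zexpD bM CM bE tE => -> ->.
  by rewrite -rotD -twistD // subrK.
have PN a : P a -> P (- a)%R.
  move=> Pa {}x {}r Dr cr; have DNr := DN Dr.
  have [] := Pa (rot r x) (- r)%R DNr; first by rewrite cN // cr opprK.
  rewrite rotK => bE tE; rewrite zexpN; split.
    exact: is_cocycle_baseV cocycleGP _ _ _ bE.
  by rewrite -[in LHS]bE (is_cocycleV cocycleGP) tE twistN // invgK.
have P1 : P 1%R.
  move=> {}x {}r Dr cr; rewrite zexp1; split.
    rewrite [LHS](skew_base_gen sGK sG'K relG_act) /sG eqxx.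
    by rewrite -[X in odometer X]cr odometerE.
  rewrite [LHS](skew_cocycle_gen sGK sG'K relG_act) /uG eqxx.
  by apply: (twist_uniq (x := x)) => //; rewrite c_rat_of_c cr.
suff : P k by exact.
elim/int_rect: k => [|n ih|n ih]; first by rewrite -(subrr 1%R); apply/PD/PN.
  by rewrite -add1n PoszD; exact: PD.
by rewrite -add1n PoszD opprD; apply: PD => //; exact: PN.
Qed.

Let inverse_H h : cocycle_inverse_at baseG twisted_base cocycleG
  twisted_cocycle h.
Proof.
elim/presented_ind: h => [|h h'|h|l].
- exact: cocycle_inverse_at1 cocycleGP twisted_is_cocycle.
- move=> Ph Ph'; exact (cocycle_inverse_atM cocycleGP twisted_is_cocycle Ph
  Ph').
- move=> Ph; exact (cocycle_inverse_atV cocycleGP twisted_is_cocycle Ph).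
move=> x; rewrite /twisted_base /twisted_cocycle.
have [b1 _ _] := cocycleGP.
rewrite skew_base_gen ?skew_cocycle_gen //; case: l => [w|r] /=; last first.
  have [Dr|nDr] := boolP (D r); first exact: cocycleG_zexp.
  by rewrite b1 (is_cocycle1 cocycleGP)
    [presented_gen _ _](relH (TwOut e v0 nDr)).
have [->|wv] := eqVneq w v0.
  by rewrite b1 (is_cocycle1 cocycleGP) -/(gH v0) gH_v0.
rewrite /baseG /cocycleG skew_base_gen ?skew_cocycle_gen //.
by rewrite /sG /uG (negbTE wv).
Qed.

Let inverse_G g : cocycle_inverse_at twisted_base baseG twisted_cocycle
  cocycleG g.
Proof.
elim/presented_ind: g => [|g g'|g|w].
- exact: cocycle_inverse_at1 twisted_is_cocycle cocycleGP.
- move=> Ph Ph'; exact (cocycle_inverse_atM twisted_is_cocycle cocycleGP Ph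
  Ph').
- move=> Ph; exact (cocycle_inverse_atV twisted_is_cocycle cocycleGP Ph).
move=> x; rewrite /baseG /cocycleG skew_base_gen ?skew_cocycle_gen //.
rewrite /sG /uG; case: ifP => wv.
  rewrite /twisted_base /twisted_cocycle skew_base_gen ?skew_cocycle_gen //=.
  by rewrite D_rat_of_c c_rat_of_c /= (eqP wv).
rewrite /twisted_base /twisted_cocycle skew_base_gen ?skew_cocycle_gen //=.
by rewrite wv.
Qed.

Lemma twisted_cocycle_vertex w x : twisted_cocycle (gH w) x
  = if w == v0 then 1 else presented_gen (raag_relators e) w.
Proof. by rewrite [LHS](skew_cocycle_gen sHK sH'K relH_act). Qed.

Lemma twisted_cocycle_twist r x : twisted_cocycle (twist r) x
  = if D r then zexp (presented_gen (raag_relators e) v0) (c r x) else 1.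
Proof. by rewrite [LHS](skew_cocycle_gen sHK sH'K relH_act). Qed.

(** At a fixed point the cocycle of [G] inverts this one; with the next lemma, it is a bijection
    from [H] to [G]. *)
Lemma twisted_cocycle_inj h h' x :
  twisted_cocycle h x = twisted_cocycle h' x -> h = h'.
Proof.
move=> hh'; have [_ <-] := inverse_H h x.
by rewrite hh'; have [] := inverse_H h' x.
Qed.

Lemma twisted_cocycle_surj x g : exists h, twisted_cocycle h x = g.
Proof. by exists (cocycleG g x); have [] := inverse_G g x. Qed.

(** The base action factors through D / Z, so one [r] serves all points; the measurability of the
    coupling rests on this. *)
Lemma twisted_base_rot h : exists2 r, D r & forall x, twisted_base h x
  = rot r x.
Proof.
have [b1 bM CM] := twisted_is_cocycle.
elim/presented_ind: h => [|h h' [r Dr rE] [s Ds sE]|h [r Dr rE]|l].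
- by exists 0%R => // x; rewrite b1 rot0.
- by exists (r + s)%R; [exact: DD|move=> x; rewrite bM sE rE rotD].
- exists (- r)%R => [|x]; first exact: DN.
  by apply: is_cocycle_baseV twisted_is_cocycle _ _ _ _; rewrite rE rotVK.
- case: l => [w|r].
    by exists 0%R => // x; rewrite /twisted_base skew_base_gen //= rot0.
  have [Dr|nDr] := boolP (D r).
    by exists r => // x; rewrite /twisted_base skew_base_gen //= Dr.
  by exists 0%R => // x; rewrite /twisted_base skew_base_gen //= (negbTE nDr)
    rot0.
Qed.

(** Freeness of the rotations detects the class of [r], so D / Z embeds in [H]. *)
Lemma twist_eq1 r (x : X) : D r -> twist r = 1 -> r \is a Num.int.
Proof.
move=> Dr r1; have [b1 _ _] := twisted_is_cocycle; apply: (@rot_free _ x).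
by have := b1 x; rewrite -r1 /twisted_base skew_base_gen //= Dr.
Qed.

Lemma twisted_raag_torsion_free (x : X) n h : (0 < n)%N ->
  (forall r, D r -> (r *+ n)%R \is a Num.int -> r \is a Num.int) ->
  h ^+ n = 1 :> H -> h = 1.
Proof.
move=> n0 Dn hn; have [b1 bM CM] := twisted_is_cocycle.
have [r Dr rE] := twisted_base_rot h.
have rnE m : twisted_base (h ^+ m) x = rot (r *+ m)%R x.
  elim: m => [|m ih]; first by rewrite b1 rot0.
  by rewrite expgS bM ih rE mulrS rotD.
have /Dn-/(_ Dr) rint : (r *+ n)%R \is a Num.int.
  by apply: (@rot_free _ x); rewrite -rnE hn b1.
have bh p : twisted_base h p = p by rewrite rE rot_int.
have bhm m : twisted_base (h ^+ m) x = x.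
  by elim: m => [|m ih]; rewrite ?b1 // expgS bM ih bh.
have Cm m : twisted_cocycle (h ^+ m) x = twisted_cocycle h x ^+ m.
  elim: m => [|m ih]; first by rewrite (is_cocycle1 twisted_is_cocycle).
  by rewrite !expgS CM bhm ih.
apply: (@twisted_cocycle_inj _ _ x); rewrite (is_cocycle1 twisted_is_cocycle).
by apply: (raag_torsion_free n0);
  rewrite -Cm hn (is_cocycle1 twisted_is_cocycle).
Qed.

End Cocycle.

End Coupling.

Local Open Scope classical_set_scope.
Local Open Scope card_scope.

Lemma countable_infinite_bij_int (T : Type) (A : set T) :
  countable A -> infinite_set A -> exists f : T -> int, set_bij A setT f.
Proof.
move=> Ac Ai; pose I : pointedType := HB.pack int (isPointed.Build int 0%R).
apply: (elimT (@card_set_bijP T I A setT)).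
apply: card_eq_trans (eq_card_nat Ac Ai) _; apply: card_esym.
apply: (eq_card_nat (countableP [set: int])); apply/infiniteP.
apply: (@card_le_trans _ _ _ (range Posz)); last exact: subset_card_le.
have inj : injective Posz by move=> ? ? [].
by rewrite (card_le_eqr (inj_card_eq (in2W inj))).
Qed.

(** * Digit expansions and the odometer *)

Section Odometer.
Local Open Scope ring_scope.
Variables (R : realType) (p : nat -> nat).
Hypothesis p_gt1 : forall n, (1 < p n)%N.
Implicit Types (x : R) (r : rat) (f g z : int) (n m : nat).

Definition level n : nat := \prod_(j < n) p j.

Lemma level0 : level 0 = 1%N. Proof. by rewrite /level big_ord0. Qed.

Lemma levelS n : level n.+1 = (level n * p n)%N.
Proof. by rewrite /level big_ord_recr. Qed.

Lemma level_gt n : (n < level n)%N.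
Proof.
elim: n => [|n ih]; first by rewrite level0.
by rewrite levelS; have := p_gt1 n; nia.
Qed.

Let p_neq0 n : (p n : int) != 0.
Proof. by have := p_gt1 n; case: (p n). Qed.

Let P_gt0 n : (0 < (level n)%:R :> R).
Proof. by rewrite ltr0n (leq_ltn_trans _ (level_gt n)). Qed.

(* The digits of f in the mixed radix system p, read in the reverse order. *)
Fixpoint digit_reversal n f : int :=
  if n is m.+1 then
    digit_reversal m (f %/ p m)%Z + (f %% p m)%Z * level m
  else 0.

Lemma digit_reversal_ge0 n f : 0 <= digit_reversal n f.
Proof.
elim: n f => //= n ih f; apply: addr_ge0 => //; apply: mulr_ge0 => //.
exact: modz_ge0.
Qed.

Let modp_lt n f : (f %% p n)%Z < p n.
Proof. by rewrite ltz_pmod //; have := p_gt1 n; lia. Qed.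

Lemma digit_reversal_lt n f : digit_reversal n f < level n.
Proof.
elim: n f => [|n ih] f /=; first by rewrite level0.
have := ih (f %/ p n)%Z; have := modp_lt n f; have := modz_ge0 f (p_neq0 n).
rewrite levelS PoszM; set a := digit_reversal _ _; set m := (f %% p n)%Z.
move=> m0 mp al; have : m * level n <= ((p n : int) - 1) * level n.
  by apply: ler_wpM2r => //; lia.
by lia.
Qed.

Let eq_digits (a b k l L : int) : 0 <= a -> a < L -> 0 <= b -> b < L ->
  a + k * L = b + l * L -> a = b /\ k = l.
Proof.
move=> a0 aL b0 bL h.
have nlt (a' b' k' l' : int) : 0 <= a' -> b' < L ->
    a' + k' * L = b' + l' * L -> ~ l' < k'.
  move=> a'0 b'L h' lk.
  have : (l' + 1) * L <= k' * L by apply: ler_wpM2r; lia.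
  by lia.
have kl : k = l.
  by have := nlt _ _ _ _ a0 bL h; have := nlt _ _ _ _ b0 aL (esym h); lia.
by split=> //; move: h; rewrite kl => /addIr.
Qed.

Lemma digit_reversal_inj n f g : digit_reversal n f = digit_reversal n g ->
  exists z, f = g + z * level n.
Proof.
elim: n f g => [|n ih] f g /=.
  by move=> _; exists (f - g); rewrite level0 mulr1 addrC subrK.
move=> /eq_digits[]; rewrite ?digit_reversal_ge0 ?digit_reversal_lt // => ab mE.
have [z zE] := ih _ _ ab; exists z.
rewrite (divz_eq f (p n)) zE mE {3}(divz_eq g (p n)) levelS PoszM; ring.
Qed.

Lemma digit_reversal_surj n (k : int) : 0 <= k < level n ->
  exists f, digit_reversal n f = k.
Proof.
elim: n k => [|n ih] k /=.
  by rewrite level0 => h; exists 0; lia.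
move=> /andP[k0 kn]; have l0 := level_gt n.
have [|f fE] := ih (k %% level n)%Z.
  rewrite modz_ge0 ?ltz_pmod //; lia.
exists (f * p n + (k %/ level n)%Z).
have dlt : 0 <= (k %/ level n)%Z < p n.
  rewrite divz_ge0 ?k0 /=; last by lia.
  by rewrite ltz_divLR; [rewrite levelS in kn; lia|lia].
rewrite divzMDl // (divz_small (d := p n) dlt) addr0 fE modzMDl
  (modz_small (d := p n) dlt).
by rewrite addrC -divz_eq.
Qed.

(** Adding a multiple of [p n] keeps the last digit, which reversal turns into the leading term;
    that term cancels. This compatibility between levels is the reason for reversing. *)
Lemma digit_reversal_shift n f z :
  digit_reversal n.+1 (f + z * p n) - digit_reversal n.+1 f
  = digit_reversal n ((f %/ p n)%Z + z) - digit_reversal n (f %/ p n)%Z.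
Proof.
by rewrite /= (addrC f) divzMDl // modzMDl (addrC z) opprD addrACA subrr addr0.
Qed.

Definition scaled_floor n x : int := Num.floor ((level n)%:R * x).

Lemma scaled_floorS n x : (scaled_floor n.+1 x %/ p n)%Z = scaled_floor n x.
Proof.
apply/esym/floor_def; set f := scaled_floor n.+1 x.
have := floor_itv ((level n.+1)%:R * x); rewrite -/(scaled_floor _ _) -/f.
rewrite levelS natrM; set L : R := (level n)%:R => /andP[f1 f2].
set q := (f %/ p n)%Z; set m := (f %% p n)%Z.
have fE : f = q * p n + m by exact: divz_eq.
have m0 : 0 <= m by exact: modz_ge0.
have mp : m + 1 <= p n by have := modp_lt n f; rewrite -/m; lia.
have pR : 0 < (p n)%:R :> R by rewrite ltr0n; have := p_gt1 n; lia.
have fR : f%:~R = q%:~R * (p n)%:R + m%:~R :> R by rewrite fE intrD intrM.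
have mR0 : 0 <= m%:~R :> R by rewrite ler0z.
have mRp : m%:~R + 1 <= (p n)%:R :> R.
  by have : (m + 1)%:~R <= (p n)%:~R :> R; [rewrite ler_int|rewrite intrD].
rewrite intrD in f2 *; apply/andP; split.
  by rewrite -(ler_pM2r pR); nra.
by rewrite -(ltr_pM2r pR); nra.
Qed.

Lemma scaled_floorD n x r z : (level n)%:R * r = z%:~R ->
  scaled_floor n (x + ratr r) = scaled_floor n x + z.
Proof.
move=> rz; rewrite /scaled_floor mulrDr.
have -> : (level n)%:R * ratr r = z%:~R :> R.
  by rewrite -(ratr_int R z) -rz rmorphM /= ratr_nat.
by rewrite floorDrz ?intrKfloor ?intr_int.
Qed.

(** With d_m the digits of [x] after the radix point, this is the sum over m < n of the d_m times
    [level m]: a truncated adic integer. *)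
Definition odometer_index n x : int := digit_reversal n (scaled_floor n x).

Definition level_rat n : pred rat := fun r => (level n)%:R * r \is a Num.int.

Lemma level_ratW n m r : (n <= m)%N -> level_rat n r -> level_rat m r.
Proof.
move=> /subnK <-; elim: (m - n)%N => //= k ih /ih.
by rewrite /level_rat addSn levelS natrM mulrAC => ?; rewrite rpredM ?rpred_nat.
Qed.

(** A shift by a multiple of 1 / [level n] changes no digit beyond the first [n], so the increment
    of the index is the same at all later levels. *)
Lemma index_shift n m x r : (n <= m)%N -> level_rat n r ->
  odometer_index m (x + ratr r) - odometer_index m x
    = odometer_index n (x + ratr r) - odometer_index n x.
Proof.
move=> /subnK <- rn; elim: (m - n)%N => //= k <-.
have /intrP[z zE] : level_rat (k + n) r by apply: level_ratW rn;
  exact: leq_addl.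
rewrite addSn /odometer_index (@scaled_floorD _ x r (z * p (k + n)));
  last first.
  by rewrite levelS natrM mulrAC zE intrM.
rewrite digit_reversal_shift (scaled_floorD _ zE).
by rewrite scaled_floorS.
Qed.

Lemma index_shift_int n x z : odometer_index n (x + z%:~R) = odometer_index n x.
Proof.
apply/eqP; rewrite -subr_eq0 -(ratr_int R z).
(* Integers already belong to level 0, where every index is 0. *)
rewrite (@index_shift 0 n) ?subrr //.
by rewrite /level_rat level0 mul1r intr_int.
Qed.

Lemma indexS n x : odometer_index n.+1 x
  = odometer_index n x + (scaled_floor n.+1 x %% p n)%Z * level n.
Proof. by rewrite /odometer_index /= scaled_floorS. Qed.

Definition level_rats : pred rat := fun r => `[< exists n, level_rat n r >].

Lemma level_ratsP r : reflect (exists n, level_rat n r) (level_rats r).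
Proof. exact: asboolP. Qed.

Lemma level_rats_subgroup : rat_subgroup level_rats.
Proof.
split=> [|r s /level_ratsP[n rn] /level_ratsP[m sm]|r /level_ratsP[n rn]].
- by apply/level_ratsP; exists 0%N; rewrite /level_rat level0 mulr1.
- apply/level_ratsP; exists (maxn n m).
  have := level_ratW (leq_maxl n m) rn; have := level_ratW (leq_maxr n m) sm.
  by rewrite /level_rat mulrDr => ? ?; rewrite rpredD.
- by apply/level_ratsP; exists n; rewrite /level_rat mulrN rpredN.
Qed.

Let archi_bound (t C : R) n : 0 <= t ->
  (forall m, (n <= m)%N -> (level m)%:R * t <= C) -> t = 0.
Proof.
move=> t0 tC; apply/eqP; rewrite eq_le t0 andbT leNgt; apply/negP => tgt0.
pose k := maxn n (Num.truncn (C / t)).+1.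
have := tC k (leq_maxl _ _); apply/negP; rewrite -ltNge.
rewrite -ltr_pdivrMr // (lt_le_trans (truncnS_gt _)) // ler_nat.
by rewrite (leq_trans (leq_maxr n _)) // ltnW // level_gt.
Qed.

(** Expansions obtained from floors never end in maximal digits: [x] would equal
    [(scaled_floor n x + 1) / level n], which is strictly larger. *)
Let nonmax_digit n x : exists2 m, (n <= m)%N &
  (scaled_floor m.+1 x %% p m)%Z != (p m : int) - 1.
Proof.
apply: contrapT => h.
have h' m : (n <= m)%N -> scaled_floor m.+1 x + 1
  = (p m : int) * (scaled_floor m x + 1).
  move=> nm; have [mE|ne] :=
    eqVneq (scaled_floor m.+1 x %% p m)%Z ((p m : int) - 1).
    by rewrite {1}(divz_eq (scaled_floor m.+1 x) (p m)) mE scaled_floorS; lia.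
  by case: h; exists m.
have key m : (n <= m)%N ->
    (level n : int) * (scaled_floor m x + 1)
      = (level m : int) * (scaled_floor n x + 1).
  move=> /subnK <-; elim: (m - n)%N => // k ih.
  rewrite addSn h' ?leq_addl // levelS PoszM mulrCA ih; ring.
pose t : R := (scaled_floor n x + 1)%:~R - (level n)%:R * x.
have t0 : 0 < t by rewrite subr_gt0; exact: floorD1_gt.
suff : t = 0 by move=> t00; rewrite t00 ltxx in t0.
apply: (@archi_bound t (level n)%:R n (ltW t0)) => m nm.
have : (level m)%:R * t = (level n)%:R *
  ((scaled_floor m x + 1)%:~R - (level m)%:R * x).
  rewrite /t !mulrBr; congr (_ - _); last by rewrite mulrCA.
  have /(congr1 (fun z => z%:~R : R)) := key m nm.
  by rewrite !intrM /= => ->.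
move=> ->; rewrite ler_piMr ?ler0n //.
by rewrite lerBlDr intrD addrC lerD2l; exact: floor_le.
Qed.

(** If all digits from [n] on vanished, [x] would be [scaled_floor n x / level n]. *)
Let nonzero_digit n x : (forall r, level_rats r -> x != ratr r) ->
  exists2 m, (n <= m)%N & (scaled_floor m.+1 x %% p m)%Z != 0.
Proof.
move=> xD; apply: contrapT => h.
have h' m : (n <= m)%N -> scaled_floor m.+1 x = (p m : int) * scaled_floor m x.
  move=> nm; have [mE|ne] := eqVneq (scaled_floor m.+1 x %% p m)%Z 0.
    by rewrite {1}(divz_eq (scaled_floor m.+1 x) (p m)) mE scaled_floorS; lia.
  by case: h; exists m.
have key m : (n <= m)%N ->
    (level n : int) * scaled_floor m x = (level m : int) * scaled_floor n x.
  move=> /subnK <-; elim: (m - n)%N => // k ih.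
  rewrite addSn h' ?leq_addl // levelS PoszM mulrCA ih; ring.
pose t : R := (level n)%:R * x - (scaled_floor n x)%:~R.
have t0 : 0 <= t by rewrite subr_ge0; exact: floor_le.
have tE : t = 0.
  apply: (@archi_bound t (level n)%:R n t0) => m nm.
  have -> : (level m)%:R * t
      = (level n)%:R * ((level m)%:R * x - (scaled_floor m x)%:~R).
    rewrite /t !mulrBr; congr (_ - _); first by rewrite mulrCA.
    have /(congr1 (fun z => z%:~R : R)) := key m nm.
    by rewrite !intrM /= => ->.
  rewrite ler_piMr ?ler0n // lerBlDr addrC.
  by have := floorD1_gt ((level m)%:R * x); rewrite intrD => /ltW.
have Ln : (level n)%:R != 0 :> rat by rewrite pnatr_eq0; have := level_gt n;
  case: level.
have xr : level_rats ((scaled_floor n x)%:~R / (level n)%:R).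
  by apply/level_ratsP; exists n; rewrite /level_rat mulrC divfK ?intr_int.
have /negP[] := xD _ xr.
rewrite fmorph_div /= rmorph_int rmorph_nat; apply/eqP.
move/eqP: tE; rewrite subr_eq0 => /eqP <-.
by rewrite mulrAC divff ?mul1r // lt0r_neq0.
Qed.

Let index_ge0 n x : 0 <= odometer_index n x. Proof. exact: digit_reversal_ge0.
  Qed.

Let index_mono n m x : (n <= m)%N -> odometer_index n x <= odometer_index m x /\
  (level n : int) - odometer_index n x <= (level m : int) - odometer_index m x.
Proof.
move=> /subnK <-; elim: (m - n)%N => //= k [ih1 ih2].
rewrite addSn indexS levelS PoszM; set d := (_ %% _)%Z.
have d0 : 0 <= d by exact: modz_ge0.
have dp : d <= (p (k + n) : int) - 1 by have :=
  modp_lt (k + n) (scaled_floor (k + n).+1 x); rewrite -/d; lia.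
have l0 : 0 <= (level (k + n) : int) by [].
have := ler_wpM2r l0 d0; have := ler_wpM2r l0 dp; lia.
Qed.

Let index_low x : (forall r, level_rats r -> x != ratr r) ->
  forall k : nat, exists n, k <= odometer_index n x :> int.
Proof.
move=> xD; elim=> [|k [n kn]]; first by exists 0%N.
have [m nm dm] := nonzero_digit n xD; exists m.+1.
rewrite indexS; set d := (_ %% _)%Z in dm *.
have d1 : 1 <= d by have : 0 <= d := modz_ge0 _ (p_neq0 m); lia.
have := ler_wpM2r (isT : 0 <= (level m : int)) d1.
have [] := index_mono x nm; have := level_gt m; lia.
Qed.

Let index_high x (k : nat) : exists n,
  (k : int) < (level n : int) - odometer_index n x.
Proof.
elim: k => [|k [n kn]].
  by exists 0%N; rewrite level0.
have [m nm dm] := nonmax_digit n x; exists m.+1.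
rewrite indexS levelS PoszM; set d := (_ %% _)%Z in dm *.
have d1 : d + 1 <= (p m : int) - 1.
  by have := modp_lt m (scaled_floor m.+1 x); rewrite -/d; lia.
have := ler_wpM2r (isT : 0 <= (level m : int)) d1.
have [] := index_mono x nm; have := level_gt m; lia.
Qed.

(** The new index has to lie between 0 and [level n]. Off the level rationals both the index and its
    distance to [level n] tend to infinity, so a large [n] works; on them the index stays
    bounded. *)
Lemma index_shift_surj x (k : int) : (forall r, level_rats r -> x != ratr r) ->
  exists n r, level_rat n r /\ odometer_index n (x + ratr r) - odometer_index n
    x = k.
Proof.
move=> xD; have [n1 n1P] := index_low xD `|k|%N.
have [n2 n2P] := index_high x `|k|%N.
have [h1 _] := index_mono x (leq_maxl n1 n2).
have [_ h2] := index_mono x (leq_maxr n1 n2); set n := maxn n1 n2 in h1 h2.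
have [|f fE] := @digit_reversal_surj n (odometer_index n x + k) _; first by lia.
have Ln : (level n)%:R != 0 :> rat by rewrite pnatr_eq0 -lt0n
  (leq_ltn_trans _ (level_gt n)).
(* The shift that changes [scaled_floor n x] into [f]. *)
exists n, ((f - scaled_floor n x)%:~R / (level n)%:R).
have rE : (level n)%:R * ((f - scaled_floor n x)%:~R / (level n)%:R)
    = (f - scaled_floor n x)%:~R :> rat by rewrite mulrC divfK.
split; first by rewrite /level_rat rE intr_int.
by rewrite {1}/odometer_index (scaled_floorD _ rE) (addrC (scaled_floor n x))
  subrK fE addrAC subrr add0r.
Qed.

Lemma index_shift_eq0 n x r : level_rat n r ->
  odometer_index n (x + ratr r) - odometer_index n x = 0 -> r \is a Num.int.
Proof.
move=> /intrP[z zE] /eqP; rewrite subr_eq0 => /eqP /digit_reversal_inj[y].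
rewrite (scaled_floorD _ zE) => /addrI zy.
have Ln : (level n)%:R != 0 :> rat by rewrite pnatr_eq0 -lt0n
  (leq_ltn_trans _ (level_gt n)).
rewrite -(mulKf Ln r) zE zy intrM mulrC -mulrA divff // mulr1; exact: intr_int.
Qed.

Definition frac_part x : R := x - (Num.floor x)%:~R.

Lemma frac_part_itv x : 0 <= frac_part x < 1.
Proof.
rewrite subr_ge0 floor_le /= ltrBlDr addrC.
by have := floorD1_gt x; rewrite intrD.
Qed.

Lemma frac_part_id x : 0 <= x < 1 -> frac_part x = x.
Proof. by move=> h; rewrite /frac_part (@floor_def _ x 0) ?subr0. Qed.

Lemma frac_partDz x z : frac_part (x + z%:~R) = frac_part x.
Proof. by rewrite /frac_part floorDrz ?intr_int // intrKfloor intrD opprD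
  addrACA subrr addr0. Qed.

Lemma frac_partD x y : frac_part (frac_part x + y) = frac_part (x + y).
Proof. by rewrite {2}/frac_part addrAC -intrN frac_partDz. Qed.

Lemma index_frac_part n x y : odometer_index n (frac_part x + y)
  = odometer_index n (x + y).
Proof. by rewrite /frac_part addrAC -intrN index_shift_int. Qed.

Definition unit_interval := {x : R | 0 <= x < 1}.
Implicit Type u : unit_interval.

Definition rotate r u : unit_interval :=
  exist _ (frac_part (sval u + ratr r)) (frac_part_itv _).

Lemma rotate0 u : rotate 0 u = u.
Proof.
by apply: val_inj; rewrite /= rmorph0 addr0 frac_part_id //; exact: (svalP u).
Qed.

Lemma rotateD r s u : rotate (r + s) u = rotate r (rotate s u).
Proof. by apply: val_inj;
  rewrite /= frac_partD rmorphD /= (addrC (ratr r)) addrA. Qed.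

Lemma rotate1 u : rotate 1 u = u.
Proof.
apply: val_inj; rewrite /= rmorph1 (frac_partDz _ 1) frac_part_id //;
  exact: (svalP u).
Qed.

Lemma rotate_free r u : rotate r u = u -> r \is a Num.int.
Proof.
move=> /(congr1 sval) /= /eqP; rewrite /frac_part -addrA addrC -subr_eq0 addrK.
rewrite subr_eq0 -(ratr_int R) => /eqP /(fmorph_inj _) ->; exact: intr_int.
Qed.

Definition rational_point u : bool :=
  `[< exists2 r, level_rats r & sval u = ratr r >].

Lemma rational_pointP u :
  reflect (exists2 r, level_rats r & sval u = ratr r) (rational_point u).
Proof. exact: asboolP. Qed.

Let subD := level_rats_subgroup.

Lemma rational_point_rotate r u : level_rats r ->
  rational_point (rotate r u) = rational_point u.
Proof.
have key s u' : level_rats s -> rational_point u' ->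
  rational_point (rotate s u').
  move=> Ds /rational_pointP[t Dt tE]; apply/rational_pointP => /=.
  rewrite tE -rmorphD /=; exists (t + s - (Num.floor (ratr (t + s) : R))%:~R).
    apply: rat_subgroupD => //; first exact: rat_subgroupD.
    apply: rat_subgroupN => //; apply/level_ratsP; exists 0%N.
    by rewrite /level_rat level0 mul1r intr_int.
  by rewrite rmorphB /= ratr_int.
move=> Dr; apply/idP/idP; last exact: key.
move=> /(key (- r) _ (rat_subgroupN subD Dr)).
by rewrite -rotateD addNr rotate0.
Qed.

Lemma rational_points_bij :
  exists b : unit_interval -> int, set_bij [set u | rational_point u] setT b.
Proof.
apply: countable_infinite_bij_int.
    have rP u : exists r, rational_point u -> sval u = ratr r.
      have [/rational_pointP[r _ rE]|_] := boolP (rational_point u);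
        last by exists 0.
      by exists r.
    apply/countable_injP; exists (fun u => choice.pickle (sval (cid (rP u)))).
    move=> u u'; rewrite !inE /= => uD u'D /(pcan_inj choice.pickleK) h.
    apply: val_inj => /=; move: h; case: cid => r /= /(_ uD) ->.
    by case: cid => r' /= /(_ u'D) -> ->.
  apply/infiniteP.
  (* [n.+1] because [level 0] is 1, whose inverse lies outside the interval. *)
  have uI n : 0 <= ((level n.+1)%:R^-1 : R) < 1.
    rewrite invr_ge0 ler0n /= invf_lt1 // ltr1n.
    exact: leq_ltn_trans (level_gt n.+1).
  pose v n : unit_interval := exist (fun x : R => 0 <= x < 1) _ (uI n).
  have vi : injective v.
    move=> n m /(congr1 sval) /= /invr_inj /eqP; rewrite eqr_nat.
    have mono k l : (k < l)%N -> (level k < level l)%N.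
      elim: l => // l ih; rewrite ltnS leq_eqVlt levelS => /orP[/eqP ->|/ih].
        have := level_gt l; have := p_gt1 l; nia.
      by have := p_gt1 l; nia.
    case: (ltngtP n m) => // nm; first by rewrite -ltnS in nm;
      have := mono _ _ nm; lia.
    by rewrite -ltnS in nm; have := mono _ _ nm; lia.
  apply: card_le_trans (subset_card_le (_ : range v `<=` _)).
    by rewrite (card_le_eqr (inj_card_eq (in2W vi))).
  move=> _ [n _ <-]; apply/rational_pointP; exists (level n.+1)%:R^-1.
    apply/level_ratsP; exists n.+1; rewrite /level_rat divff //.
    by rewrite pnatr_eq0 -lt0n (leq_ltn_trans _ (level_gt n.+1)).
  by rewrite [RHS]fmorphV rmorph_nat.
Qed.

Definition rational_label := sval (cid rational_points_bij).

(** The value 0 is a default off [level_rats]; on it any level containing [r] would do, by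
    [index_shift]. *)
Definition level_of r : nat :=
  if pselect (exists n, level_rat n r) is left h then sval (cid h) else 0%N.

(* The odometer cocycle; the rational points, on which it is not onto, are
   relabelled by the integers. *)
Definition odometer_cocycle r u : int :=
  if rational_point u then rational_label (rotate r u) - rational_label u
  else odometer_index (level_of r) (sval u + ratr r) - odometer_index
    (level_of r) (sval u).

Let level_ofP r : level_rats r -> level_rat (level_of r) r.
Proof.
rewrite /level_of => /level_ratsP h; case: pselect => // h'.
by case: cid.
Qed.

Let odometer_cocycleE n r u : ~~ rational_point u -> level_rat n r ->
  odometer_cocycle r u = odometer_index n (sval u + ratr r) - odometer_index n
    (sval u).
Proof.
move=> /negbTE uD rn; rewrite /odometer_cocycle uD.
have rl : level_rat (level_of r) r by apply: level_ofP; apply/level_ratsP;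
  exists n.
rewrite -(index_shift _ (leq_maxl (level_of r) n) rl).
by rewrite (index_shift _ (leq_maxr (level_of r) n) rn).
Qed.

Lemma odometer_orbit_cocycle : orbit_cocycle level_rats rotate odometer_cocycle.
Proof.
have [_ lab_inj lab_surj] := svalP (cid rational_points_bij).
rewrite -/rational_label in lab_inj lab_surj.
split; [exact: rotate0|exact: rotate1|exact: rotateD|exact: rotate_free|..].
- move=> u; have [uD|uD] := boolP (rational_point u).
    by rewrite /odometer_cocycle uD rotate1 subrr.
  have r1 : level_rat 0 1 by rewrite /level_rat level0 mulr1.
  by rewrite (odometer_cocycleE uD r1) rmorph1 (index_shift_int 0 _ 1) subrr.
- move=> r s u Dr Ds; have [uD|uD] := boolP (rational_point u).
    rewrite /odometer_cocycle rational_point_rotate // uD rotateD.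
    by rewrite addrA subrK.
  have suD : ~~ rational_point (rotate s u) by rewrite rational_point_rotate.
  have [/level_ratsP[n rn] /level_ratsP[m sm]] := (Dr, Ds).
  have rn' := level_ratW (leq_maxl n m) rn;
    have sm' := level_ratW (leq_maxr n m) sm.
  rewrite (odometer_cocycleE suD rn') (odometer_cocycleE uD sm').
  rewrite (@odometer_cocycleE (maxn n m)) //; last first.
    by rewrite /level_rat mulrDr; apply: rpredD.
  rewrite index_frac_part -[sval (rotate s u)]addr0 index_frac_part addr0.
  by rewrite rmorphD /= (addrC (ratr r)) !addrA subrK.
- move=> r u Dr; have [uD|uD] := boolP (rational_point u).
    rewrite /odometer_cocycle uD => /eqP; rewrite subr_eq0 => /eqP /lab_inj.
    by rewrite !inE /= rational_point_rotate // => /(_ uD uD) /rotate_free.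
  by rewrite (odometer_cocycleE uD (level_ofP Dr));
    apply: index_shift_eq0 (level_ofP Dr).
- move=> u k; have [uD|uD] := boolP (rational_point u).
    have [u' /= u'D u'E] := lab_surj (k + rational_label u) I.
    have [/rational_pointP[r Dr rE] /rational_pointP[s Ds sE]] := (uD, u'D).
    (* The rational points form a single orbit: [s - r] rotates [u] to [u']. *)
    exists (s - r); first exact: rat_subgroupD (rat_subgroupN _ _).
    have -> : odometer_cocycle (s - r) u = rational_label u' - rational_label u.
      rewrite /odometer_cocycle uD; congr (rational_label _ - _).
      apply: val_inj; rewrite /= rmorphB /= rE addrC subrK -sE frac_part_id //.
      exact: (svalP u').
    by rewrite u'E addrK.
  have [|n [r [rn rE]]] := @index_shift_surj (sval u) k.
    by move=> r Dr; apply: contra uD => /eqP uE; apply/rational_pointP;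
      exists r.
  exists r; first by apply/level_ratsP; exists n.
  by rewrite (odometer_cocycleE uD rn).
Qed.

End Odometer.

(** * Piecewise rational translations of the line *)

Section PiecewiseTranslation.
Local Open Scope classical_set_scope.
Local Open Scope ring_scope.
Variable R : realType.
Implicit Types (x y : R) (A : set R).

Notation mu := (@lebesgue_measure R).

Let shift (a : R) : R -> measurableTypeR R := fun x => x + a.

Let measurable_shift a : measurable_fun setT (shift a : R -> R).
Proof. exact: measurable_funD. Qed.

Lemma lebesgue_measure_shift a A : measurable A ->
  mu ((fun x => x + a) @^-1` A) = mu A.
Proof.
move=> mA; rewrite -[LHS]/(pushforward mu (shift a) A).
apply/esym/lebesgue_measure_unique => //=; first exact: measurable_shift.
move=> _ _ [[x y] _ <-] /=; rewrite /pushforward.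
have -> : shift a @^-1` `]x, y] = `]x - a, y - a]%classic.
  by apply/seteqP; split => z /=; rewrite !in_itv /= ltrBlDr lerBrDr.
rewrite !lebesgue_measure_itv /= !lte_fin ltrD2r; case: ifP => // _.
by rewrite -!EFinB; congr EFin; lra.
Qed.

Lemma measurable_preimage_shift a A : measurable A ->
  measurable ((fun x => x + a) @^-1` A).
Proof. by move=> mA; have := measurable_shift a measurableT mA;
  rewrite setTI. Qed.

(** For countable [C], measurability with respect to the discrete sigma-algebra, without equipping
    [C] with it. *)
Definition level_measurable (C : Type) (f : R -> C) :=
  forall c, measurable (f @^-1` [set c]).

Lemma level_measurable_cst (C : Type) (c : C) :
  level_measurable (fun=> c).
Proof.
move=> c'; have [->|cc'] := pselect (c = c').
  by rewrite [X in measurable X](_ : _ = setT) //; apply/seteqP; split.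
by rewrite [X in measurable X](_ : _ = set0) //; apply/seteqP; split.
Qed.

Lemma level_measurable_shift (C : Type) (f : R -> C) a :
  level_measurable f -> level_measurable (fun x => f (x + a)).
Proof. by move=> mf c; have := measurable_preimage_shift a (mf c). Qed.

Lemma level_measurable_bigcup (B C : Type) (f : R -> B) (g : B -> R -> C) :
  countable [set: B] -> level_measurable f ->
  (forall b, level_measurable (g b)) -> level_measurable (fun x => g (f x) x).
Proof.
move=> cB mf mg c.
rewrite [X in measurable X](_ : _
  = \bigcup_b (f @^-1` [set b] `&` g b @^-1` [set c])).
  apply: countable_bigcupT_measurable => // b.
  by apply: measurableI; [exact: mf|exact: mg].
apply/seteqP; split => [x /= xc|x [b _ [/= <-]]] //.
by exists (f x).
Qed.

Lemma level_measurable_comp (B C : Type) (f : R -> B) (phi : B -> C) :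
  countable [set: B] -> level_measurable f -> level_measurable (phi \o f).
Proof.
move=> cB mf; apply: (level_measurable_bigcup (g := fun b=> cst (phi b))) => //.
by move=> b; exact: level_measurable_cst.
Qed.

Lemma level_measurable_comp2 (B C D : Type) (f : R -> B) (g : R -> C)
    (phi : B -> C -> D) : countable [set: B] -> countable [set: C] ->
  level_measurable f -> level_measurable g ->
  level_measurable (fun x => phi (f x) (g x)).
Proof.
move=> cB cC mf mg.
apply: (level_measurable_bigcup (g := fun b x => phi b (g x))) => // b.
exact: (level_measurable_comp (phi b)).
Qed.

Lemma level_measurable_floor (f : R -> R) :
  measurable_fun setT f -> level_measurable (fun x => Num.floor (f x)).
Proof.
move=> mf k; have := mf measurableT _ (measurable_itv `[k%:~R, (k + 1)%:~R[).
rewrite setTI; congr measurable; apply/seteqP; split => x /=; rewrite in_itv /=.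
  exact: floor_def.
by move=> <-; exact: floor_itv.
Qed.

Definition piecewise_translation (f : R -> R) :=
  exists2 d : R -> rat, level_measurable d & forall x, f x = x + ratr (d x).

Let countable_rat : countable [set: rat]. Proof. exact: countableP. Qed.

Section Preimage.
Variables (f : R -> R) (d : R -> rat).
Hypotheses (md : level_measurable d) (fE : forall x, f x = x + ratr (d x)).

(** Pieces indexed by [nat] fit countable additivity; each rational gets exactly one index. *)
Let rat_enum : exists e : nat -> option rat,
  (forall q, exists n, e n = Some q) /\
  (forall n m q, e n = Some q -> e m = Some q -> n = m).
Proof.
exists pickle_inv; split=> [q|n m q nq mq].
  by exists (choice.pickle q); rewrite pickleK_inv.
have := @pickle_invK rat n; have := @pickle_invK rat m.
by rewrite nq mq; move=> /= -> ->.
Qed.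

Let enum := sval (cid rat_enum).

Let enum_ex q : exists n, enum n = Some q.
Proof. by have [] := svalP (cid rat_enum). Qed.

Let enum_inj n m q : enum n = Some q -> enum m = Some q -> n = m.
Proof. by have [_ +] := svalP (cid rat_enum); exact. Qed.

Let source A n : set R := if enum n is Some q then
  d @^-1` [set q] `&` (fun x => x + ratr q) @^-1` A else set0.

Let target A n : set R := if enum n is Some q then
  (fun x => x - ratr q) @^-1` (d @^-1` [set q]) `&` A else set0.

Let preimage_source A : f @^-1` A = \bigcup_n source A n.
Proof.
apply/seteqP; split => [x /= Afx|x [n _]].
  have [n nE] := enum_ex (d x); exists n => //.
  by rewrite /source nE; split => //=; rewrite -fE.
by rewrite /source; case: enum => // q [/= <-]; rewrite -fE.
Qed.

Let measurable_source A n : measurable A -> measurable (source A n).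
Proof.
rewrite /source => mA; case: enum => // q; apply: measurableI;
  [exact: md|exact: measurable_preimage_shift].
Qed.

Lemma measurable_preimage_piecewise A : measurable A -> measurable (f @^-1` A).
Proof.
move=> mA; rewrite preimage_source; apply: bigcupT_measurable => n.
exact: measurable_source.
Qed.

(** Translation by the rational of index [n] carries [source A n] onto [target A n]. Injectivity
    makes the targets disjoint, surjectivity makes them cover [A]. *)
Lemma lebesgue_measure_piecewise A : injective f ->
  (forall y, exists x, f x = y) ->
  measurable A -> mu (f @^-1` A) = mu A.
Proof.
move=> f_inj f_surj mA.
have targetE : A = \bigcup_n target A n.
  apply/seteqP; split => [y Ay|y [n _]].
    have [x xy] := f_surj y; have [n nE] := enum_ex (d x); exists n => //.
    by rewrite /target nE; split => //=; rewrite -xy fE addrK.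
  by rewrite /target; case: enum => // q [].
have mtarget n : measurable (target A n).
  rewrite /target; case: enum => // q; apply: measurableI => //.
  exact: (measurable_preimage_shift (- ratr q) (md q)).
rewrite preimage_source [in RHS]targetE !measure_semi_bigcup //.
- apply: eq_eseriesr => n _; rewrite /source /target.
  case: enum => // q; apply: etrans (lebesgue_measure_shift (ratr q) _).
    by congr (mu _); apply/seteqP; split => x /=; rewrite addrK.
  by apply: measurableI => //;
    exact: (measurable_preimage_shift (- ratr q) (md q)).
- move=> n m _ _ [y []]; rewrite /target.
  case nE: (enum n) => [q|//] [/= dq _];
    case mE: (enum m) => [q'|//] [/= dq' _].
  have xx : y - ratr q = y - ratr q'.
    by apply: f_inj; rewrite !fE dq dq' !subrK.
  by apply: enum_inj nE _; rewrite mE -dq -dq' xx.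
- by rewrite -targetE.
- by move=> n; exact: measurable_source.
- move=> n m _ _ [y []]; rewrite /source.
  case nE: (enum n) => [q|//] [/= dq _];
    case mE: (enum m) => [q'|//] [/= dq' _].
  by apply: enum_inj nE _; rewrite mE -dq -dq'.
- by rewrite -preimage_source; exact: measurable_preimage_piecewise.
Qed.

End Preimage.

Lemma standard_borel_R : standard_borel R (measurableTypeR R).
Proof.
exists R, idfun; split; [exact: Rhausdorff| |exact: (Bijective (g := idfun))|].
  exists (range (@ratr R)); last exact: dense_rat.
  exact: sub_countable (card_image_le _ _) countable_rat.
move=> B; rewrite preimage_id; split=> [|mB].
  apply: smallest_sub; first exact: sigma_algebra_measurable.
  by move=> A; exact: open_measurable.
have : <<s @RGenOpens.G R >> B.
  exact (eq_ind _ (fun M : set (set R) => M B) mB _ (RGenOpens.measurableE R)).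
apply: sub_smallest2r => //.
by move=> _ [a [b ->]]; exact: interval_open.
Qed.

End PiecewiseTranslation.

(** * A coupling on the real line from a bijective cocycle *)

Section MeasureEquivalence.
Local Open Scope classical_set_scope.
Local Open Scope ring_scope.
Local Open Scope group_scope.
Variables (R : realType) (G H : groupType).
Let U := unit_interval R.
Variables (b : H -> U -> U) (C : H -> U -> G).
Hypotheses (countableG : countable [set: G])
  (infiniteG : infinite_set [set: G]).
Hypothesis cocycleC : is_cocycle b C.
Hypothesis C_inj : forall h h' u, C h u = C h' u -> h = h'.
Hypothesis C_surj : forall u g, exists h, C h u = g.
Hypothesis b_rotate : forall h, exists r, forall u, b h u = rotate r u.

Definition unit_part (x : R) : U := exist _ (frac_part x) (frac_part_itv x).

Hypothesis measurableC : forall h,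
  level_measurable (fun x => C h (unit_part x)).

Let label : G -> int := sval
  (cid (countable_infinite_bij_int countableG infiniteG)).

Let label_bij : set_bij setT setT label.
Proof. exact: svalP (cid (countable_infinite_bij_int countableG infiniteG)).
  Qed.

Let label_inj : injective label.
Proof.
by have [_ inj _] := label_bij; move=> g g'; apply: inj; rewrite in_setT.
Qed.

Let unlabel_ex k : exists g, label g = k.
Proof. by have [_ _ surj] := label_bij; have [g _] := surj k I; exists g. Qed.

Let unlabel k : G := sval (cid (unlabel_ex k)).

Let unlabelK : cancel unlabel label.
Proof. by move=> k; exact: svalP (cid (unlabel_ex k)). Qed.

Let labelK : cancel label unlabel.
Proof. by move=> g; apply: label_inj; rewrite unlabelK. Qed.

(** The copy of [U] over [g] becomes the unit interval starting at [label g], so the line with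
    Lebesgue measure is a model of [U * G]. *)
Let cut (x : R) : U * G := (unit_part x, unlabel (Num.floor x)).
Let glue (ug : U * G) : R := (sval ug.1 + (label ug.2)%:~R)%R.

Let cutK : cancel cut glue.
Proof. by move=> x; rewrite /glue /= unlabelK /frac_part subrK. Qed.

Let glueK : cancel glue cut.
Proof.
move=> [u g]; rewrite /cut /glue /=.
have fu : Num.floor (sval u) = 0%R by apply: floor_def; exact: (svalP u).
congr pair; first by apply: val_inj; rewrite /= frac_partDz frac_part_id //;
  exact: (svalP u).
by rewrite floorDrz ?intr_int // intrKfloor fu add0r labelK.
Qed.

(** [G] multiplies on the right, hence commutes with the left multiplication by the cocycle of
    [H]. *)
Let act (gh : G * H) (ug : U * G) : U * G :=
  (b gh.2 ug.1, C gh.2 ug.1 * ug.2 * gh.1^-1).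

Let coupling gh (x : R) : R := glue (act gh (cut x)).

Let b1 := let: And3 h _ _ := cocycleC in h.
Let bM := let: And3 _ h _ := cocycleC in h.
Let CM := let: And3 _ _ h := cocycleC in h.

Let act1 ug : act 1 ug = ug.
Proof.
by case: ug => u g; rewrite /act /= b1 (is_cocycle1 cocycleC) mul1g invg1 mulg1.
Qed.

Let actM gh gh' ug : act (gh * gh') ug = act gh (act gh' ug).
Proof.
by case: ug => u g; rewrite /act /= bM CM invgM !mulgA.
Qed.

Let coupling_split gh x : cut (coupling gh x) = act gh (cut x).
Proof. exact: glueK. Qed.

Let coupling_action : is_action coupling.
Proof.
split=> [x|g h x]; first by rewrite /coupling act1 cutK.
by rewrite /coupling glueK actM.
Qed.

Let coupling_piecewise gh : piecewise_translation (coupling gh).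
Proof.
case: gh => g h; have [r rE] := b_rotate h.
have cZ : countable [set: int] by exact: countableP.
(* [k] and [l] are the floors of [x + ratr r] and [x]: subtracting [k] leads back to the unit
   interval, and [l] encodes the [G]-coordinate. *)
pose d (k l : int) (c : G) : rat :=
  (r - k%:~R + (label (c * unlabel l * g^-1))%:~R)%R.
exists (fun x => d (Num.floor (x + ratr r)%R) (Num.floor x)
  (C h (unit_part x))).
  apply: (level_measurable_bigcup
    (g := fun k x => d k (Num.floor x) (C h (unit_part x)))) => //.
    by apply: level_measurable_floor; exact: measurable_funD.
  move=> k; apply: (@level_measurable_comp2 _ _ _ _ _ _ (d k)) => //.
  exact: level_measurable_floor.
move=> x; rewrite /coupling /glue /= rE /= frac_partD /d /frac_part.
by rewrite rmorphD rmorphB /= !ratr_int -!addrA.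
Qed.

Let coupling_bij gh : bijective (coupling gh).
Proof.
have [c1 cM] := coupling_action.
by exists (coupling gh^-1) => x; rewrite -cM ?mulVg ?mulgV c1.
Qed.

Let mu : {measure set (measurableTypeR R) -> \bar R} := lebesgue_measure.

Let coupling_mp : measure_preserving_action mu coupling.
Proof.
have [c1 cM] := coupling_action.
split=> // [gh _ A mA|gh A mA]; have [d md dE] := coupling_piecewise gh.
  by rewrite setTI; exact: (measurable_preimage_piecewise md dE).
have [h' hK h'K] := coupling_bij gh.
apply: (lebesgue_measure_piecewise md dE) => //; first exact: can_inj hK.
by move=> y; exists (h' y).
Qed.

Let base : set R := [set x | (cut x).2 = 1].

Let base_itv : base = `[(label 1)%:~R, (label 1 + 1)%:~R[%classic.
Proof.
apply/seteqP; split => x /=; rewrite in_itv /= => xE.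
  by rewrite -xE unlabelK; exact: floor_itv.
by rewrite /base /cut /= (floor_def xE) labelK.
Qed.

Let measurable_base : measurable (base : set (measurableTypeR R)).
Proof. by rewrite base_itv; exact: measurable_itv. Qed.

Let base_finite : (mu base < +oo)%E.
Proof.
rewrite base_itv [mu _]lebesgue_measure_itv /=; case: ifP => _; exact: ltry.
Qed.

Let coupling_image gh x : (coupling gh @` base) x <-> (act gh^-1 (cut x)).2 = 1.
Proof.
have [c1 cM] := coupling_action.
split=> [[y yE <-]|xE].
  by rewrite coupling_split -actM mulVg act1.
exists (coupling gh^-1 x); last by rewrite -cM mulgV c1.
by rewrite -[base _]/((cut _).2 = 1) coupling_split.
Qed.

Let coupling_fixed gh x : coupling gh x = x -> act gh (cut x) = cut x.
Proof. by move=> h; rewrite -coupling_split h. Qed.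

Lemma measure_equivalent_of_cocycle : measure_equivalent R G H.
Proof.
exists (sigma_display (@measurable _ (ocitv_type R))), (measurableTypeR R), mu,
  coupling.
move=> aG aH.
split; first split.
- exact: standard_borel_R.
- exact: sigma_finiteT.
- apply/eqP; rewrite -measure_le0 -ltNge.
  apply: (@lt_le_trans _ _ (mu `[0%R, 1%R]%classic)).
    by rewrite [mu _]lebesgue_measure_itv /= lte_fin ltr01 oppr0 adde0 lte_fin
      ltr01.
  by apply: le_measure; rewrite ?inE //; exact: measurable_itv.
- exact: coupling_mp.
split.
- apply: aeW => x g /coupling_fixed /(congr1 snd) /=.
  rewrite (is_cocycle1 cocycleC) mul1g => /eqP.
  by rewrite -[X in _ == X]mulg1 => /eqP /mulgI /eqP; rewrite invg_eq1 => /eqP.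
- apply: aeW => x h /coupling_fixed /(congr1 snd) /=; rewrite invg1 mulg1.
  rewrite -[X in _ = X]mul1g => /mulIg hE.
  by apply: (C_inj (u := unit_part x)); rewrite hE (is_cocycle1 cocycleC).
- exists base; last exact: base_finite.
  split=> [|| g g' gg']; first exact: measurable_base.
    apply: aeW => x; exists (cut x).2^-1; apply/coupling_image => /=.
    by rewrite invg1 (is_cocycle1 cocycleC) mul1g invgK mulgV.
  rewrite (_ : _ `&` _ = set0); first exact: negligible_set0.
  rewrite -subset0 => x [/coupling_image /= + /coupling_image /=].
  rewrite invg1 (is_cocycle1 cocycleC) mul1g !invgK => gE g'E.
  by apply: gg'; apply: (mulgI (unlabel (Num.floor x))); rewrite gE g'E.
- exists base; last exact: base_finite.
  split=> [|| h h' hh']; first exact: measurable_base.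
    (* The [h] that moves the [G]-coordinate of [x] to 1. *)
    apply: aeW => x; have [h hE] := C_surj (cut x).1 (cut x).2^-1.
    exists h^-1; apply/coupling_image => /=.
    by rewrite !invg1 invgK mulg1 hE mulVg.
  rewrite (_ : _ `&` _ = set0); first exact: negligible_set0.
  rewrite -subset0 => x [/coupling_image /= + /coupling_image /=].
  rewrite !invg1 !mulg1 => hE h'E; apply: hh'; apply: invg_inj.
  apply: (C_inj (u := unit_part x)); apply: (mulIg (unlabel (Num.floor x))).
  by rewrite hE h'E.
Qed.

End MeasureEquivalence.

(** * Torsion as an obstruction to commensurability *)

Section Commensurability.
Local Open Scope classical_set_scope.
Local Open Scope group_scope.

Lemma commensurable_up_to_finite_kernels_sym (H1 H2 : groupType) :
  commensurable_up_to_finite_kernels H1 H2 ->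
  commensurable_up_to_finite_kernels H2 H1.
Proof.
move=> [S1 [S2 [F1 [F2 [fi1 fi2 fin1 fin2 [f [g fK gK]]]]]]].
exists S2, S1, F2, F1; split => //.
have gM : {morph g : x y / x * y} by move=> x y;
  rewrite -[x in LHS]gK -[y in LHS]gK -gmulfM fK.
pose g' : {multiplicative quotient_group F2 -> quotient_group F1} :=
  HB.pack g (isMultiplicative.Build _ _ g gM).
by exists g'; exists f.
Qed.

Lemma coset_classM (G : groupType) (N : normal_subgroup G) (x y : G) :
  coset_class N (x * y) = coset_class N x * coset_class N y.
Proof.
apply/coset_classP; rewrite coset_rel_sym.
by apply: coset_relM; exact: coset_rel_repr.
Qed.

Lemma coset_classX (G : groupType) (N : normal_subgroup G) (x : G) n :
  coset_class N (x ^+ n) = coset_class N x ^+ n.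
Proof. by elim: n => // n ih; rewrite !expgS coset_classM ih. Qed.

Lemma coset_class_eq1 (G : groupType) (N : normal_subgroup G) (x : G) :
  coset_class N x = 1 <-> x \in (N : groupClosed G).
Proof.
split=> [/coset_classP|xN]; last first.
  by apply/coset_classP; rewrite coset_rel_sym /coset_rel invg1 mul1g.
by rewrite coset_rel_sym /coset_rel invg1 mul1g.
Qed.

Lemma subgroup_valX (G : groupType) (S : groupClosed G) (x : subgroup S) n :
  val (x ^+ n) = val x ^+ n.
Proof. exact: gmulfXn. Qed.

Lemma finite_powers_torsion (G : groupType) (x : G) (A : set G) :
  finite_set A -> (forall n, A (x ^+ n)) -> exists2 n, (0 < n)%N & x ^+ n = 1.
Proof.
move=> finA xA; apply: contrapT => h.
have inj : injective (fun n => x ^+ n).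
  move=> n m; wlog : n m / (n <= m)%N => [hw|].
    by case/orP: (leq_total n m) => ? /esym ?; [apply: hw|apply/esym/hw].
  rewrite leq_eqVlt => /orP[/eqP //|nm] /= xnm.
  case: h; exists (m - n)%N; first by rewrite subn_gt0.
  by rewrite (expgnFr x (ltnW nm)) -xnm mulgV.
apply: infinite_nat; apply: (@sub_finite_set _ _ ((fun n => x ^+ n) @^-1` A)).
  by move=> n _; exact: xA.
by apply: finite_preimage => // ? ? _ _; exact: inj.
Qed.

Lemma coprime_expg_eq1 (G : groupType) (x : G) m n : (0 < m)%N ->
  coprime m n -> x ^+ m = 1 -> x ^+ n = 1 -> x = 1.
Proof.
move=> m0 /eqP cmn xm xn; have [a _] := Bezoutl n m0; rewrite cmn.
move=> /dvdnP[k kE].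
have <- : x ^+ (1 + a * n) = x.
  by rewrite expgnDr expg1 mulnC expgnA xn expg1n mulg1.
by rewrite kE mulnC expgnA xm expg1n.
Qed.

(** Some [(f a0)^-1 * f a] has a nontrivial class of q-power order. Its image lifts to some [y], of
    finite order because [F2] is finite. As [H2] has no q-torsion, a power of [y] prime to [q] is
    trivial, so the class of [y] is trivial by coprimality. *)
Lemma torsion_not_commensurable (H1 H2 : groupType) (q : nat) (f : nat -> H1) :
  prime q -> injective f ->
  (forall a b, exists n, ((f a)^-1 * f b) ^+ (q ^ n) = 1) ->
  (forall h : H2, h ^+ q = 1 -> h = 1) ->
  ~ commensurable_up_to_finite_kernels H1 H2.
Proof.
move=> q_prime f_inj f_tors H2_tors.
move=> [S1 [S2 [F1 [F2 [fi1 _ fin1 fin2 [phi [psi phiK _]]]]]]].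
pose coset g := [set g * x | x in [set` S1]] : set H1.
(* Pigeonhole: [S1] has finitely many cosets. *)
have [a0 inf_a0] : exists a0, infinite_set [set a | coset (f a) = coset (f a0)].
  apply: contrapT => h; apply: infinite_nat.
  have -> : [set: nat] = \bigcup_(c in range (coset \o f))
    [set a | coset (f a) = c].
    by apply/seteqP; split => // a _; exists (coset (f a)) => //; exists a.
  apply: bigcup_finite => [|_ [a0 _ <-]]; last by apply: contrapT => ?;
    apply: h; exists a0.
  by apply: sub_finite_set fi1 => _ [a _ <-]; exists (f a).
have in_S1 a : coset (f a) = coset (f a0) -> (f a0)^-1 * f a \in S1.
  move=> E; have : coset (f a) (f a) by exists 1; rewrite ?mulg1 //;
    exact: gpred1.
  by rewrite E => -[x /= xS1 <-]; rewrite mulKg.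
(* The finite [F1] cannot contain the infinitely many quotients found in [S1]. *)
have [x xF1 [n xn]] : exists2 x : subgroup S1, x \notin (F1 : groupClosed _) &
    exists n, x ^+ (q ^ n) = 1.
  apply: contrapT => h; apply: inf_a0.
  apply: (@sub_finite_set _ _ ((fun a => (f a0)^-1 * f a) @^-1`
      (val @` [set` (F1 : groupClosed (subgroup S1))]))).
    move=> a /= /in_S1 aS1; pose x : subgroup S1 :=
      exist (fun z => z \in S1) _ aS1.
    exists x => //; apply: contrapT => /negP nF1; apply: h; exists x => //.
    have [n fn] := f_tors a0 a; exists n; apply: val_inj.
    by rewrite subgroup_valX fn.
  apply: finite_preimage; last exact: finite_image.
  by move=> a b _ _ /mulgI /f_inj.
have phi1 : phi 1 = 1 by apply: (mulgI (phi 1)); rewrite -gmulfM !mulg1.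
have phiX z k : phi (z ^+ k) = phi z ^+ k.
  by elim: k => [|k ih]; rewrite ?expg0 // !expgS gmulfM ih.
set y := repr (phi (coset_class F1 x)).
have yE : coset_class F2 y = phi (coset_class F1 x) by exact: coset_reprK.
have yn : coset_class F2 y ^+ (q ^ n) = 1.
  by rewrite yE -phiX -coset_classX xn [coset_class F1 1](_ : _ = 1).
have y_neq1 : coset_class F2 y <> 1.
  rewrite yE -phi1 => /(can_inj phiK) /coset_class_eq1 xF1'.
  by rewrite xF1' in xF1.
have [|m m0 ym] := @finite_powers_torsion _ (y ^+ (q ^ n)) _ fin2.
  by move=> k /=; apply: gpredXn; apply/coset_class_eq1; rewrite coset_classX.
(* [m'] is the part of [m] prime to [q]; the rest of the exponent is removed by [q_tors]. *)
have [m' cm' mE] := pfactor_coprime q_prime m0.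
have q_tors k (h : H2) : h ^+ (q ^ k) = 1 -> h = 1.
  elim: k h => [|k ih] h; first by rewrite expn0 expg1.
  by rewrite expnS expgnA => /ih /H2_tors.
have ym' : val y ^+ m' = 1.
  apply: (q_tors (logn q m + n)%N);
    rewrite -expgnA expnD mulnA -mE mulnC expgnA.
  by rewrite -!subgroup_valX ym.
apply: y_neq1; apply: (@coprime_expg_eq1 _ _ (q ^ n) m') => //.
- by rewrite expn_gt0 prime_gt0.
- exact: coprimeXl.
rewrite -coset_classX (_ : y ^+ m' = 1) //; apply: val_inj.
by rewrite subgroup_valX ym'.
Qed.

End Commensurability.

(** * Cardinality of right-angled Artin groups *)

Section InfiniteRaag.
Local Open Scope classical_set_scope.
Local Open Scope card_scope.
Local Open Scope ring_scope.
Variables (V : finType) (e : rel V) (v0 : V).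

Lemma countable_raag : countable [set: raag e].
Proof. exact/countable_presented/countableP. Qed.

Lemma infinite_raag : infinite_set [set: raag e].
Proof.
(* The exponent sum, which kills commutators and separates the powers of a generator. *)
pose f (l : V * bool) (z : int) : int := if l.2 then z - 1 else 1 + z.
have fK v b z : f (v, b) (f (v, ~~ b) z) = z by case: b; rewrite /f /=; lia.
have frel w z : raag_relators e w -> foldr f z w = z.
  by move=> [v [u [_ ->]]]; rewrite /f /=; lia.
pose x := presented_gen (raag_relators e) v0.
have xE n : presented_act f (x ^+ n)%g 0 = n%:Z.
  elim: n => [|n ih]; first by rewrite expg0 presented_act1.
  by rewrite expgS presented_actM // presented_act_gen // ih /f.
apply/infiniteP.
have inj : injective (fun n => (x ^+ n)%g).
  by move=> n m /(congr1 (fun g => presented_act f g 0)); rewrite !xE => -[].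
apply: (@card_le_trans _ _ _ (range (fun n => (x ^+ n)%g))).
  by rewrite (card_le_eqr (inj_card_eq (in2W inj))).
exact: subset_card_le.
Qed.

End InfiniteRaag.

(** * Radices attached to sets of primes *)

Section OddPrimes.

(** [prime_above] need not return the next prime: an increasing sequence of odd primes is enough. *)
Fixpoint odd_prime k : nat :=
  if k is k'.+1 then s2val (prime_above (odd_prime k')) else 3.

Lemma odd_prime_prime k : prime (odd_prime k).
Proof. by case: k => //= k; case: prime_above. Qed.

Lemma odd_prime_ltn k l : (k < l)%N -> (odd_prime k < odd_prime l)%N.
Proof.
elim: l => // l ih; rewrite ltnS leq_eqVlt => /orP[/eqP ->|/ih kl] /=.
  by case: prime_above.
by apply: ltn_trans kl _; case: prime_above.
Qed.

Lemma odd_prime_gt2 k : (2 < odd_prime k)%N.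
Proof. by case: k => // k; apply: ltnW; exact: (@odd_prime_ltn 0). Qed.

Lemma odd_prime_inj : injective odd_prime.
Proof.
by move=> k l; case: (ltngtP k l) => // /odd_prime_ltn; lia.
Qed.

(* All but finitely many terms are divisible by odd_prime k if i k holds, and
   none is otherwise. *)
Definition radix (i : nat -> bool) (n : nat) : nat :=
  2 * \prod_(k < n | i k) odd_prime k.

(** Ensured by the factor 2 even if [i] is nowhere true; the primes that code [i] are odd for this
    reason. *)
Lemma radix_gt1 i n : (1 < radix i n)%N.
Proof.
rewrite /radix; have : (0 < \prod_(k < n | i k) odd_prime k)%N.
  by rewrite prodn_gt0 // => k; apply: prime_gt0; exact: odd_prime_prime.
by lia.
Qed.

(** The radices of index greater than [k] contribute one factor each, whence the offset [k.+1]. *)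
Lemma dvdn_level_radix (i : nat -> bool) k m : i k ->
  (odd_prime k ^ m %| level (radix i) (k.+1 + m))%N.
Proof.
move=> ik; elim: m => [|m ih]; first exact: dvd1n.
rewrite addnS levelS expnSr dvdn_mul // /radix dvdn_mull //.
have km : (k < k.+1 + m)%N by lia.
by rewrite (bigD1 (Ordinal km)) //= dvdn_mulr.
Qed.

Lemma coprime_level_radix (i : nat -> bool) k n : ~~ i k ->
  coprime (odd_prime k) (level (radix i) n).
Proof.
move=> nik; elim: n => [|n ih]; first by rewrite level0 coprimen1.
rewrite levelS coprimeMr ih /= /radix coprimeMr; apply/andP; split.
  rewrite prime_coprime ?odd_prime_prime // gtnNdvd //; exact: odd_prime_gt2.
apply: (big_ind (fun m => coprime (odd_prime k) m)).
- exact: coprimen1.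
- by move=> a b ha hb; rewrite coprimeMr ha.
- move=> l il; rewrite prime_coprime ?odd_prime_prime //.
  rewrite dvdn_prime2 ?odd_prime_prime //; apply: contra nik => /eqP.
  by move=> /odd_prime_inj ->.
Qed.

End OddPrimes.

(** * Measurability of the odometer cocycle *)

Section MeasurableCocycle.
Local Open Scope classical_set_scope.
Local Open Scope ring_scope.
Variables (R : realType) (p : nat -> nat) (p_gt1 : forall n, (1 < p n)%N).

Let countable_int : countable [set: int]. Proof. exact: countableP. Qed.

Lemma level_measurable_index n (r : R) :
  level_measurable (fun x => odometer_index p n (x + r)).
Proof.
apply: (level_measurable_comp (digit_reversal p n)) => //.
apply: level_measurable_floor; apply: measurable_funM => //.
exact: measurable_funD.
Qed.

Lemma countable_rational_part :
  countable [set x : R | rational_point p (unit_part x)].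
Proof.
apply: sub_countable (_ : countable (range (@ratr R))); last first.
  by apply: sub_countable (card_image_le _ _) _; exact: countableP.
apply: subset_card_le => x /rational_pointP[r _ /= xr].
exists (r + (Num.floor x)%:~R) => //.
by rewrite rmorphD /= ratr_int -xr subrK.
Qed.

(** The labelling of the rational points is arbitrary, but all subsets of a countable set are
    measurable; elsewhere the cocycle is computed from floors. *)
Lemma level_measurable_odometer_cocycle r :
  level_measurable (fun x : R => odometer_cocycle p_gt1 r (unit_part x)).
Proof.
move=> k; rewrite /odometer_cocycle; set n := level_of p r.
pose f (x : R) := odometer_index p n (x + ratr r) - odometer_index p n (x + 0).
have mf : level_measurable f.
  apply: (@level_measurable_comp2 _ _ _ _ _ _ (fun a b => a - b)) => //;
  exact: level_measurable_index.
set Q := [set x : R | rational_point p (unit_part x)].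
rewrite [X in measurable X](_ : _ =
    (Q `&` [set x | rational_label p_gt1 (rotate r (unit_part x))
       - rational_label p_gt1 (unit_part x) = k]) `|`
         (~` Q `&` f @^-1` [set k])).
  have mQ A : measurable (Q `&` A).
    apply: countable_measurable => [t|]; first exact: measurable_set1.
    apply: sub_countable countable_rational_part.
    by apply: subset_card_le => x [].
  apply: measurableU => //; apply: measurableI; last exact: mf.
  by apply: measurableC; rewrite -[Q]setIT.
have fE x : odometer_index p n (sval (unit_part x) + ratr r) - odometer_index p
  n (sval (unit_part x)) = f x.
  by rewrite /f -[X in _ - odometer_index p n X = _]addr0 !index_frac_part.
apply/seteqP; split => x /=; case: ifPn => xr; rewrite ?fE => xk.
- by left.
- by right; split => //; exact/negP.
- by case: xk => [[]//|[]].
- by case: xk => [[] | []] //; move/negP: xr.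
Qed.

End MeasurableCocycle.

(** * Measure equivalence of the twisted groups *)

Section TwistedRaag.
Local Open Scope classical_set_scope.
Local Open Scope ring_scope.
Local Open Scope group_scope.
Variables (R : realType) (V : finType) (e : rel V) (v0 : V).
Hypotheses (e_sym : symmetric e) (e_irr : irreflexive e).
Variables (p : nat -> nat) (p_gt1 : forall n, (1 < p n)%N).

Let D := level_rats p.
Let H := twisted_raag e v0 D.
Let c := @odometer_cocycle R p p_gt1.
Let base : H -> unit_interval R -> unit_interval R :=
  twisted_base (@rotate R) c.
Let cocycle : H -> unit_interval R -> raag e := twisted_cocycle (@rotate R) c.
Let subD : rat_subgroup D := level_rats_subgroup p.
Let cP := odometer_orbit_cocycle R p_gt1.

Let rotate_unit_part r (x : R) : rotate r (unit_part x)
  = unit_part (x + ratr r)%R.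
Proof. by apply: val_inj; rewrite /= frac_partD. Qed.

Lemma twisted_raag_measure_equivalent : measure_equivalent R (raag e) H.
Proof.
have cocycleP := twisted_is_cocycle e_sym v0 e_irr subD cP.
have [b1 bM CM] := cocycleP.
apply: (@measure_equivalent_of_cocycle R (raag e) H base cocycle).
- exact: countable_raag.
- exact: infinite_raag.
- exact: cocycleP.
- by move=> h h' u; exact: twisted_cocycle_inj.
- by move=> u g; exact: twisted_cocycle_surj.
- move=> h; have [r _ rE] := twisted_base_rot e_sym e_irr subD cP h.
  by exists r.
have bE h : exists r, forall x, base h (unit_part x) = unit_part (x + ratr r)%R.
  have [r _ rE] := twisted_base_rot e_sym e_irr subD cP h.
  by exists r => x; rewrite -rotate_unit_part; exact: rE.
have cG := @countable_raag V e.
(* Measurability passes to products and inverses because [base] lifts to translations of the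
   line. *)
elim/presented_ind => [|h h' mh mh'|h mh|[w|r]].
- rewrite (_ : (fun x => _) = fun=> 1); first exact: level_measurable_cst.
  by apply/funext => x; exact: (is_cocycle1 cocycleP).
- have [r rE] := bE h'.
  rewrite (_ : (fun x => _) = fun x : R =>
      cocycle h (unit_part (x + ratr r)%R) * cocycle h' (unit_part x)).
    apply: (level_measurable_comp2
      (f := fun x => cocycle h (unit_part (x + ratr r)%R))) => //.
    exact: (level_measurable_shift (f := fun x => cocycle h (unit_part x))).
  by apply/funext => x; rewrite -rE; exact: CM.
- have [r rE] := bE h^-1.
  rewrite (_ : (fun x => _) = fun x :
    R => (cocycle h (unit_part (x + ratr r)%R))^-1).
    apply: (@level_measurable_comp _ _ _
      (fun x => cocycle h (unit_part (x + ratr r)%R))) => //.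
    exact: (level_measurable_shift (f := fun x => cocycle h (unit_part x))).
  apply/funext => x; rewrite -rE -[RHS](is_cocycleV cocycleP).
  by congr (cocycle _ _); rewrite -[RHS]bM mulgV b1.
- rewrite (_ : (fun x => _)
  = fun=> if w == v0 then 1 else presented_gen (raag_relators e) w).
    exact: level_measurable_cst.
  by apply/funext => x; exact: (twisted_cocycle_vertex e_sym v0 e_irr subD cP).
rewrite (_ : (fun x => _) = fun x : R =>
  if D r then zexp (presented_gen (raag_relators e) v0) (c r (unit_part x))
    else 1).
  case: (D r); last exact: level_measurable_cst.
  apply: (@level_measurable_comp _ _ _ (fun x => c r (unit_part x)));
    first exact: countableP.
  exact: level_measurable_odometer_cocycle.
by apply/funext => x; exact: (twisted_cocycle_twist e_sym v0 e_irr subD cP).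
Qed.

End TwistedRaag.

(** * Torsion of the vertex groups D / Z *)

Section RadixTorsion.
Local Open Scope ring_scope.
Variables (i : nat -> bool) (k : nat).

Lemma odd_primeX_level_rats a : i k ->
  level_rats (radix i) ((odd_prime k ^ a)%N%:R^-1).
Proof.
move=> ik; apply/level_ratsP; exists (k.+1 + a)%N.
have /dvdnP[b bE] := dvdn_level_radix a ik.
rewrite /level_rat bE natrM mulfK; first exact: rpred_nat.
by rewrite pnatr_eq0 -lt0n expn_gt0 prime_gt0 // odd_prime_prime.
Qed.

Lemma level_rats_odd_prime_torsion r : ~~ i k -> level_rats (radix i) r ->
  r *+ odd_prime k \is a Num.int -> r \is a Num.int.
Proof.
move=> nik /level_ratsP[n rn] rq.
have [a _] := Bezoutl (level (radix i) n) (prime_gt0 (odd_prime_prime k)).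
rewrite (eqP (coprime_level_radix n nik)) => /dvdnP[b bE].
(* The Bezout relation is [1 + a * level (radix i) n = b * odd_prime k]; both terms on the right are
   integers. *)
have -> : r = (r *+ odd_prime k) *+ b - ((level (radix i) n)%:R * r) *+ a.
  rewrite -mulrnA mulnC -bE mulrnDr mulr1n mulr_natl -mulrnA mulnC addrK //.
by rewrite rpredB // rpredMn.
Qed.

Lemma inv_expn_sub_notin_int q a b : (1 < q)%N -> (a < b)%N ->
  ((q ^ a)%N%:R^-1 - (q ^ b)%N%:R^-1 : rat) \isn't a Num.int.
Proof.
move=> q1 ab; have qa : (0 < q ^ a)%N by rewrite expn_gt0; lia.
have qb : (0 < q ^ b)%N by rewrite expn_gt0; lia.
apply/negP => /intrP[z zE].
have lt : ((q ^ b)%N%:R^-1 < (q ^ a)%N%:R^-1 :> rat).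
  by rewrite ltf_pV2 ?posrE ?ltr0n // ltr_nat ltn_exp2l.
have z0 : 0 < z by rewrite -(ltr0z rat) -zE subr_gt0.
have : (z%:~R < 1 :> rat).
  rewrite -zE ltrBlDr (@le_lt_trans _ _ 1) //.
    by rewrite invf_le1 ?ltr0n // ler1n.
  by rewrite ltrDl invr_gt0 ltr0n.
by rewrite -[1]/(1%:~R) ltr_int; lia.
Qed.

End RadixTorsion.

(** * Distinct sets of primes give non-commensurable groups *)

Section NotCommensurable.
Local Open Scope group_scope.
Variables (R : realType) (V : finType) (e : rel V) (v0 : V).
Hypotheses (e_sym : symmetric e) (e_irr : irreflexive e).

Let H i := twisted_raag e v0 (level_rats (radix i)).
Let subD i : rat_subgroup (level_rats (radix i)) :=
  level_rats_subgroup (radix i).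
Let cP i := odometer_orbit_cocycle R (radix_gt1 i).
Let u0 : unit_interval R := unit_part 0%R.

Lemma twisted_raag_not_commensurable (i j : nat -> bool) k : i k -> ~~ j k ->
  ~ commensurable_up_to_finite_kernels (H i) (H j).
Proof.
move=> ik njk; set q := odd_prime k.
have q_gt1 : (1 < q)%N by apply: prime_gt1; exact: odd_prime_prime.
pose r a : rat := ((q ^ a)%N%:R^-1)%R.
have Dr a : level_rats (radix i) (r a) by exact: odd_primeX_level_rats.
have DrN a : level_rats (radix i) (- r a)%R by exact: rat_subgroupN.
have DrB a b : level_rats (radix i) (r a - r b)%R by exact: rat_subgroupD.
have twB a b : twist e v0 (level_rats (radix i)) (r a - r b)%R
    = twist e v0 _ (r a) * (twist e v0 _ (r b))^-1.
  by rewrite (twistD _ _ (Dr a) (DrN b)) (twistN _ _ (subD i)).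
apply: (@torsion_not_commensurable _ _ q (fun a => twist e v0 _ (r a))).
- exact: odd_prime_prime.
- suff lt a b : (a < b)%N -> twist e v0 (level_rats (radix i)) (r a)
      <> twist e v0 _ (r b).
    by move=> a b; case: (ltngtP a b) => // /lt h E; case: h.
  move=> ab E; have : twist e v0 (level_rats (radix i)) (r a - r b)%R = 1.
    by rewrite twB E mulgV.
  move/(twist_eq1 e_sym e_irr (subD i) (cP i) u0 (DrB a b)).
  by apply/negP; exact: inv_expn_sub_notin_int.
(* Multiplication by [q ^ (a + b)] makes both [r a] and [r b] integers. *)
- move=> a b; exists (a + b)%N; rewrite -(twistN _ _ (subD i)) //.
  rewrite -(twistD _ _ (DrN a) (Dr b)) addrC.
  have twX n : level_rats (radix i) ((r b - r a) *+ n)%R /\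
      twist e v0 (level_rats (radix i)) (r b - r a)%R ^+ n
      = twist e v0 _ ((r b - r a) *+ n)%R.
    elim: n => [|n [Dn ih]].
      rewrite expg0 mulr0n (twist0 _ _ (subD i)); split=> //.
      by rewrite -(subrr (r a)).
    rewrite expgS mulrS ih (twistD _ _ (DrB b a) Dn); split=> //.
    exact: rat_subgroupD.
  rewrite (twX _).2; apply: (twist_int _ _ (subD i)).
  have qX c : ((q ^ c)%N%:R != 0 :> rat)%R.
    by rewrite pnatr_eq0 -lt0n expn_gt0; lia.
  rewrite mulrnBl expnD; apply: rpredB.
    by rewrite mulnC -mulr_natl natrM mulrAC divff // mul1r rpred_nat.
  by rewrite -mulr_natl natrM mulrAC divff // mul1r rpred_nat.
- move=> h hq; apply: (twisted_raag_torsion_free e_sym e_irr (subD j) (cP j) u0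
  _ _ hq).
    exact: ltnW.
  by move=> s Ds; exact: (level_rats_odd_prime_torsion njk Ds).
Qed.

End NotCommensurable.

Theorem theorem4p1 (R : realType) (V : finType) (e : rel V)
    (e_sym : symmetric e) (e_irr : irreflexive e) (V_nonempty : (0 < #|V|)%N) :
  exists H : (nat -> bool) -> groupType,
    (forall i, countable [set: H i]) /\
    (forall i, measure_equivalent R (raag e) (H i)) /\
    (forall i j, i <> j -> ~ commensurable_up_to_finite_kernels (H i) (H j)).
Proof.
(* A vertex is indispensable: groups measure equivalent to the trivial group are finite, hence all
   commensurable up to finite kernels. *)
have [v0 _] := card_gt0P V_nonempty.
exists (fun i => twisted_raag e v0 (level_rats (radix i))); split; [|split].
- by move=> i; apply: countable_presented; exact: countableP.
- by move=> i; apply: twisted_raag_measure_equivalent => //; exact: radix_gt1.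
- move=> i j ij; have [k ijk] : exists k, i k <> j k.
    by apply: contrapT => h; apply: ij; apply/funext => k;
      apply: contrapT => ?; apply: h; exists k.
  case ik: (i k); case jk: (j k) ijk; rewrite ?ik // => _.
    by apply: (@twisted_raag_not_commensurable R _ _ _ _ _ _ _ k);
      rewrite ?ik ?jk.
  (* The torsion criterion is one-sided, and here [k] belongs to [j] only. *)
  move/commensurable_up_to_finite_kernels_sym.
  by apply: (@twisted_raag_not_commensurable R _ _ _ _ _ _ _ k);
    rewrite ?ik ?jk.
Qed.
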